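(* Let $D$ be a nonzero integer and let $E_D$ be the elliptic curve $y^2=x^3+Dx$ over $\mathbb{Q}$. (i) Assume the Hardy-Littlewood Conjecture. Then the Lang-Trotter Conjecture holds for $E_D$. Moreover, for every nonzero integer $r$ there is a constant $\delta\ge 0$ (depending on $D$ and $r$) such that $$\pi_{E_D,2r}(x)\sim \delta\cdot\frac{\sqrt{x}}{\log x}\quad\text{as } x\to\infty .$$ (ii) Conversely, if for some nonzero integers $D$ and $r$ the Lang-Trotter Conjecture holds for $E_D$ and the trace value $2r$ with a positive constant $C_{E_D,2r}$, i.e. $\pi_{E_D,2r}(x)=C_{E_D,2r}\frac{\sqrt{x}}{\log x}+o\left(\frac{\sqrt{x}}{\log x}\right)$ with $C_{E_D,2r}>0$, then the polynomial $x^2+r^2$ represents infinitely many primes.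
   Context: For an elliptic curve $E/\mathbb{Q}$ with discriminant $\Delta_E$ and a prime $p\nmid\Delta_E$, $a_p=1+p-\#\tilde E_p(\mathbb{F}_p)$. For an integer $m$, $\pi_{E,m}(x)=\#\{p\le x:\ p \text{ prime},\ p\nmid\Delta_E,\ a_p=m\}$. Lang-Trotter Conjecture for $E$: for every integer $m$ (with $m\ne 0$ if $E$ has complex multiplication, as is the case for $E_D$) there is a constant $C_{E,m}\ge 0$ with $\pi_{E,m}(x)=C_{E,m}\frac{\sqrt{x}}{\log x}+o\left(\frac{\sqrt{x}}{\log x}\right)$ as $x\to\infty$. Convention: when the constant is $0$, the asymptotic is interpreted as saying that only finitely many primes $p$ have $a_p=m$ (the same convention applies to $\sim\delta\sqrt{x}/\log x$ with $\delta=0$). Hardy-Littlewood Conjecture: for all integers $a,b,c$ with $a>0$, $\gcd(a,b,c)=1$, $a+b$ and $c$ not both even, and $\Delta=b^2-4ac$ not a perfect square, the number $P(n)$ of primes less than $n$ of the form $ax^2+bx+c$ (with $x$ a nonnegative integer) satisfies $P(n)\sim\delta(a,b,c)\frac{\sqrt{n}}{\log n}$ as $n\to\infty$, where $$\delta(a,b,c)=\frac{\gcd(2,a+b)}{\sqrt{a}}\prod_{p\mid a,\ p\mid b,\ p>2}\frac{p}{p-1}\ \prod_{p\nmid a,\ p>2}\left(1-\frac{\left(\frac{\Delta}{p}\right)}{p-1}\right),$$ the products being over primes (the second taken in increasing order of $p$) and $\left(\frac{\cdot}{p}\right)$ being the Legendre symbol. *)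

(* Defs.v *)
From mathcomp Require Import all_boot all_order all_algebra.
From mathcomp Require Import all_classical all_reals all_analysis.

Set Implicit Arguments.
Unset Strict Implicit.
Unset Printing Implicit Defensive.

Import Order.TTheory GRing.Theory Num.Theory.
Import numFieldNormedType.Exports.

Local Open Scope classical_set_scope.
Local Open Scope ring_scope.

(* Weierstrass equation y^2 + a1 xy + a3 y = x^3 + a2 x^2 + a4 x + a6 over Z;
   the curve over Q is elliptic iff its discriminant is nonzero. *)
Record weierstrass := Weierstrass
  { wa1 : int; wa2 : int; wa3 : int; wa4 : int; wa6 : int }.

Definition wdisc (E : weierstrass) : int :=
  let: Weierstrass a1 a2 a3 a4 a6 := E in
  let b2 := a1 ^+ 2 + 4 * a2 in
  let b4 := 2 * a4 + a1 * a3 in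
  let b6 := a3 ^+ 2 + 4 * a6 in
  let b8 := a1 ^+ 2 * a6 + 4 * a2 * a6 - a1 * a3 * a4 + a2 * a3 ^+ 2
            - a4 ^+ 2 in
  - b2 ^+ 2 * b8 - 8 * b4 ^+ 3 - 27 * b6 ^+ 2 + 9 * b2 * b4 * b6.

Definition on_curve (E : weierstrass) (F : fieldType) (P : F * F) : bool :=
  let: Weierstrass a1 a2 a3 a4 a6 := E in
  let: (x, y) := P in
  y ^+ 2 + a1%:~R * x * y + a3%:~R * y
    == x ^+ 3 + a2%:~R * x ^+ 2 + a4%:~R * x + a6%:~R.

(* The successor accounts for the point at infinity.
   Only meaningful for p prime, since 'F_p depends only on the smallest prime
   divisor of p. *)
Definition npoints (E : weierstrass) (p : nat) : nat :=
  #|[set P : 'F_p * 'F_p | on_curve E P]|.+1.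

Definition frob_trace (E : weierstrass) (p : nat) : int :=
  1 + p%:Z - (npoints E p)%:Z.

Definition trace_prime (E : weierstrass) (m : int) (p : nat) : bool :=
  [&& prime p, ~~ (p%:Z %| wdisc E)%Z & frob_trace E p == m].

Section Asymptotics.
Variable R : realType.

Definition sqrt_over_log (x : R) : R := Num.sqrt x / ln x.

(* For x >= 0, p <= x iff p < (Num.truncn x).+1; for x < 0 the count is 0. *)
Definition trace_count (E : weierstrass) (m : int) (x : R) : R :=
  #|[set p : 'I_(Num.truncn x).+1 | trace_prime E m p]|%:R.

Definition at_infty : filter_on R := FilterType (pinfty_nbhs R) _.

Definition trace_asymptotic (E : weierstrass) (m : int) (C : R) : Prop :=
  trace_count E m
    = (fun x : R => C * sqrt_over_log x) +o_at_infty sqrt_over_log.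

Definition trace_equivalent (E : weierstrass) (m : int) (C : R) : Prop :=
  trace_count E m ~_at_infty (fun x : R => C * sqrt_over_log x).

Definition trace_finite (E : weierstrass) (m : int) : Prop :=
  finite_set [set p : nat | trace_prime E m p].

(* The Lang-Trotter conjecture for a curve with complex multiplication, whence
   the exclusion of m = 0.  For the constant 0, the asymptotic means
   finiteness. *)
Definition Lang_Trotter_CM (E : weierstrass) : Prop :=
  forall m : int, m != 0 ->
  exists2 C : R, 0 <= C &
    if C == 0 then trace_finite E m else trace_asymptotic E m C.

Definition legendre (d : int) (p : nat) : int :=
  if (p%:Z %| d)%Z then 0
  else if [exists x : 'I_p, (p%:Z %| (x%:Z ^+ 2 - d))%Z] then 1
  else -1.

Definition HL_const (a b c : int) : R :=
  let D := b ^+ 2 - 4 * a * c in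
  (gcdz 2 (a + b))%:~R / Num.sqrt a%:~R
  * (\prod_(p <- primes `|a|%N | (2 < p)%N && (p%:Z %| b)%Z)
       (p%:R / (p%:R - 1)))
  * limn (fun N : nat =>
      \prod_(0 <= p < N | [&& prime p, (2 < p)%N & ~~ (p%:Z %| a)%Z])
         (1 - (legendre D p)%:~R / (p%:R - 1)) : R).

Definition quad_prime (a b c : int) (p : nat) : Prop :=
  prime p /\ exists x : nat, p%:Z = a * x%:Z ^+ 2 + b * x%:Z + c.

Definition quad_count (a b c : int) (n : nat) : R :=
  #|[set p : 'I_n | `[< quad_prime a b c p >]]|%:R.

(* The zero-constant convention is kept here too; it is harmless, since
   HL_const a b c is positive under the hypotheses. *)
Definition Hardy_Littlewood : Prop :=
  forall a b c : int, 0 < a -> gcdz (gcdz a b) c = 1 ->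
  ~~ ((2 %| a + b)%Z && (2 %| c)%Z) ->
  ~ (exists k : int, b ^+ 2 - 4 * a * c = k ^+ 2) ->
  if HL_const a b c == 0 then finite_set [set p : nat | quad_prime a b c p]
  else quad_count a b c
         ~_ \oo (fun n : nat => HL_const a b c * sqrt_over_log n%:R).

End Asymptotics.

(* y^2 = x^3 + D x, with discriminant -64 D^3 *)
Definition curve_E (D : int) : weierstrass := Weierstrass 0 0 0 D 0.

(* Main.v *)
Require Import Defs.
From mathcomp Require Import all_boot all_order all_algebra all_field.
From mathcomp Require Import cyclic.
From mathcomp Require Import all_classical all_reals all_analysis.
From mathcomp Require Import zify ring lra.
Set Implicit Arguments.
Unset Strict Implicit.
Unset Printing Implicit Defensive.
Import Order.TTheory GRing.Theory Num.Theory.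
Import numFieldNormedType.Exports.
Local Open Scope classical_set_scope.
Local Open Scope ring_scope.

(** Let p = 4k+1 be a prime not dividing D, fix w in F_p with w^2 = -1, and let
    chi be the quartic character with chi(x) = i^j when x^k = w^j.  Summing
    over the fibres of x, the number of points of y^2 = x^3 + D x is governed
    by the Jacobi sum J = sum chi(x) chi^2(1-x) = A + B i in Z[i]:
    a_p = - 2 (-1)^k Re (conj(chi(D)) J) ([curve_char_sum]).  Gauss sums give
    A^2 + B^2 = p, so a_p = 2r forces p = r^2 + s^2; when p = 3 mod 4 the trace
    vanishes.  This already yields (ii): if x^2 + r^2 took finitely many prime
    values, then the count of primes with a_p = 2r would be bounded, while
    C sqrt x / log x is not.

    For (i), let p = r^2 + s^2 and choose w = - r / s, the image of i modulo
    r + s i.  Then J is divisible by r + s i, hence J = u (r + s i) for a unit u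
    ([jacobi_assoc]), and u is determined by J = -1 mod 2+2i
    ([jacobi_primary]).  So a_p = 2r says that a certain fourth root of unity,
    built from u, chi(D) and the parity of k, equals 1.  The key point is that
    chi(D) depends only on s modulo 16|D| ([qindex_periodic]): this is the part
    of quartic reciprocity that concerns rational integers D.  For an odd prime
    divisor l of D, the l-th power of the Gauss sum G of chi is computed twice
    in a finite field of characteristic l, by the Frobenius map and from
    G^4 = J^2 p; this expresses chi(l) through J and p modulo l
    ([quartic_residue1], [quartic_residue3]).  For l = 2, an idea of
    Dirichlet: (r+s)^2 = 2rs mod p reduces chi(2) to the quadratic character of
    r + s, which is a function of r + s mod 8 ([qindex2]).

    Hence, apart from divisors of the discriminant, the primes with a_p = 2r
    are those of the form r^2 + s^2, s >= 0, with s in certain residue classes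
    t modulo M = 16|D| ([frob_trace_periodic]), that is, the primes represented
    by the polynomials (M x + t)^2 + r^2.  Their discriminant - 4 M^2 r^2 is
    not a square.  Such a polynomial either has a fixed divisor, and then
    represents at most one prime, or falls under the Hardy-Littlewood
    conjecture.  As a prime determines s, the classes contribute disjoint sets
    of primes, and the asymptotics can be added ([trace_dichotomy]).  Finally
    sqrt x / log x is insensitive to replacing x by the next integer
    ([sqrt_over_log_succ_truncn]). *)

(** * Gauss sums over finite fields *)

Section GaussSums.
Variables (K : finFieldType) (F : fieldType).
Implicit Types (c d : K -> F) (x y g t : K).

Definition mulchar c := [/\ c 0 = 0, c 1 = 1 & {morph c : x y / x * y}].

Definition jacobi_sum c d : F := \sum_x c x * d (1 - x).

Lemma mulchar_neq0 c x : mulchar c -> x != 0 -> c x != 0.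
Proof.
move=> [_ c1 cM] x0; apply/eqP => cx0.
by move: (oner_neq0 F); rewrite -c1 -(mulfV x0) cM cx0 mul0r eqxx.
Qed.

Lemma mulcharV c x : mulchar c -> x != 0 -> c x^-1 = (c x)^-1.
Proof.
move=> mc x0; apply: (mulfI (mulchar_neq0 mc x0)).
by rewrite mulfV ?mulchar_neq0//; case: mc => _ c1 <-; rewrite mulfV.
Qed.

Lemma sum_mulchar c g : mulchar c -> g != 0 -> c g != 1 -> \sum_x c x = 0.
Proof.
move=> [_ _ cM] g0 cg; apply/eqP; rewrite -[_ == 0]orFb -(negbTE cg).
rewrite -(subr_eq0 (c g)) -mulf_eq0 mulrBl mul1r subr_eq0 mulr_sumr.
rewrite [X in _ == X](reindex_inj (mulfI g0)) /=.
by apply/eqP/eq_bigr => x _; rewrite cM.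
Qed.

Variable psi : K -> F.
Hypothesis psiD : forall x y, psi (x + y) = psi x * psi y.
Hypothesis psi0 : psi 0 = 1.
Hypothesis psi_nt : exists a, psi a != 1.

Definition gauss_sum c : F := \sum_x c x * psi x.

Lemma sum_addchar t : t != 0 -> \sum_x psi (t * x) = 0.
Proof.
move=> t0; case: psi_nt => a pa.
rewrite -(reindex_inj (mulfI t0) (P := xpredT)) /=.
apply/eqP; rewrite -[_ == 0]orFb -(negbTE pa).
rewrite -(subr_eq0 (psi a)) -mulf_eq0 mulrBl mul1r subr_eq0 mulr_sumr.
rewrite [X in _ == X](reindex_inj (addrI a)) /=.
by apply/eqP/eq_bigr => x _; rewrite psiD.
Qed.

Lemma gauss_sum_scale c t : mulchar c -> t != 0 ->
  \sum_x c x * psi (t * x) = c t^-1 * gauss_sum c.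
Proof.
move=> [_ _ cM] t0; rewrite /gauss_sum mulr_sumr.
rewrite [RHS](reindex_inj (mulfI t0)) /=.
by apply: eq_bigr => x _; rewrite mulrA -cM mulKf.
Qed.

(** Collect the terms of the double sum with x + y = z; the substitution
    x = z u shows that the coefficient of psi z is c z * d z times the Jacobi
    sum, and for z = 0 it is a sum of the nontrivial character c d. *)
Lemma gauss_sumM c d g : mulchar c -> mulchar d -> g != 0 -> c g * d g != 1 ->
  gauss_sum c * gauss_sum d =
  jacobi_sum c d * gauss_sum (fun x => c x * d x).
Proof.
move=> mc md g0 cdg.
have mcd : mulchar (fun x => c x * d x).
  case: mc md => [c0 c1 cM] [d0 d1 dM]; split; first by rewrite c0 mul0r.
    by rewrite c1 d1 mulr1.
  by move=> x y; rewrite cM dM mulrACA.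
have -> : gauss_sum c * gauss_sum d = \sum_z (\sum_x c x * d (z - x)) * psi z.
  rewrite /gauss_sum mulr_suml.
  under [RHS]eq_bigr do rewrite mulr_suml.
  rewrite exchange_big /=; apply: eq_bigr => x _; rewrite mulr_sumr.
  rewrite [RHS](reindex_inj (addrI x)) /=; apply: eq_bigr => y _.
  by rewrite [x + y - x]addrC addKr psiD mulrACA.
rewrite [RHS]mulr_sumr; apply: eq_bigr => z _; rewrite mulrA; congr (_ * _).
have [->|z0] := eqVneq z 0.
  rewrite [X in _ = _ * X](_ : _ = 0) ?mulr0; last by case: mcd.
  have [_ _ dM] := md.
  transitivity (d (-1) * \sum_x c x * d x).
    rewrite mulr_sumr; apply: eq_bigr => x _.
    by rewrite sub0r -[- x]mulN1r dM mulrCA.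
  by rewrite (sum_mulchar mcd g0 cdg) mulr0.
rewrite (reindex_inj (mulfI z0)) /= /jacobi_sum mulr_suml.
apply: eq_bigr => x _; case: mc md => [_ _ cM] [_ _ dM].
by rewrite -{2}[z]mulr1 -mulrBr cM dM; ring.
Qed.

(** Put y = x u in the double sum: since c d = 1, the inner sum over x
    is a complete sum of the additive character x |-> psi ((1+u) x), which
    vanishes unless u = -1. *)
Lemma gauss_sumMV c d g : mulchar c -> mulchar d -> g != 0 -> d g != 1 ->
  (forall x, x != 0 -> c x * d x = 1) ->
  gauss_sum c * gauss_sum d = d (-1) * #|K|%:R.
Proof.
move=> mc md g0 dg cd1; case: (mc) (md) => [c0 _ cM] [d0 _ dM].
have -> : gauss_sum c * gauss_sum d =
    \sum_u d u * \sum_(x | x != 0) psi ((1 + u) * x).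
  rewrite /gauss_sum mulr_suml (bigD1 0) //= c0 !mul0r add0r.
  under [RHS]eq_bigr do rewrite mulr_sumr.
  rewrite exchange_big /=; apply: eq_bigr => x x0.
  rewrite mulr_sumr (reindex_inj (mulfI x0)) /=; apply: eq_bigr => u _.
  by rewrite mulrACA -psiD dM mulrA cd1 // mul1r mulrDl mul1r (mulrC u).
have S0 u : \sum_(x | x != 0) psi ((1 + u) * x) =
    (u == -1)%:R * #|K|%:R - 1.
  have sumE : \sum_x psi ((1 + u) * x) =
      1 + \sum_(x | x != 0) psi ((1 + u) * x).
    by rewrite (bigD1 0) //= mulr0 psi0.
  apply: (addrI 1); rewrite -sumE [RHS]addrC subrK.
  rewrite -addr_eq0 [u + 1]addrC.
  have [u1|u1] := eqVneq (1 + u) 0; last by rewrite sum_addchar // mul0r.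
  rewrite mul1r; under eq_bigr do rewrite u1 mul0r psi0.
  by rewrite sumr_const cardT -cardE.
under eq_bigr do rewrite S0 mulrBr mulr1.
rewrite sumrB (sum_mulchar md g0 dg) subr0 (bigD1 (-1)) //= eqxx mul1r.
by rewrite big1 ?addr0 // => u /negbTE ->; rewrite mul0r mulr0.
Qed.

End GaussSums.

(** * The quartic index *)

Lemma prim_root_i (R : fieldType) (i : R) :
  2%:R != 0 :> R -> i ^+ 2 = -1 -> 4.-primitive_root i.
Proof.
move=> R2 i2; have i4 : i ^+ 4 = 1 by rewrite (exprM i 2 2) i2 sqrrN expr1n.
have [[|m] //= pm m4] := prim_order_exists (isT : (0 < 4)%N) i4.
suff m2 : ~~ (m.+1 %| 2)%N.
  by move: pm m2; case: m m4 => [|[|[|[|m]]]] // /dvdn_leq -/(_ isT).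
rewrite (prim_order_dvd pm) i2 eq_sym -subr_eq0 opprK.
by rewrite -(natrD _ 1 1).
Qed.

(** The sum of all elements is invariant under x |-> x + 1. *)
Lemma card_finField0 (K : finFieldType) : #|K|%:R = 0 :> K.
Proof.
have : \sum_(x : K) x = \sum_(x : K) (x + 1) by exact: (reindex_inj (addIr 1)).
rewrite big_split /= -[LHS]addr0 => /addrI ->.
by rewrite sumr_const cardT -cardE.
Qed.

Lemma expf_card_pred (K : finFieldType) (x : K) : x != 0 -> x ^+ #|K|.-1 = 1.
Proof.
move=> x0; apply: (mulfI x0); rewrite -exprS mulr1 prednK ?expf_card //.
by apply/card_gt0P; exists 0.
Qed.

Lemma ex_finField_generator (K : finFieldType) :
  exists g : K, (#|K|.-1).-primitive_root g.
Proof.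
pose rs := [seq x <- enum K | x != 0].
have urs : uniq rs by rewrite filter_uniq ?enum_uniq.
have K1 : (0 < #|K|.-1)%N by have := finNzRing_gt1 K; case: #|K| => [|[]].
suff /hasP[g _ gp] : has (#|K|.-1).-primitive_root rs by exists g.
apply: has_prim_root => //.
  apply/allP => x; rewrite mem_filter => /andP[x0 _].
  exact/unity_rootP/expf_card_pred.
rewrite size_filter -(leq_add2r (count (pred1 0) (enum K))) addnC.
rewrite [X in (_ <= X)%N]addnC count_predC -cardE.
rewrite count_uniq_mem ?enum_uniq // mem_enum add1n prednK //.
exact: ltnW (finNzRing_gt1 K).
Qed.

(** Together with [im_expi], the coordinates of i^n.  Keeping Gaussian
    integers as pairs of integers lets the same Jacobi sum be read in every
    field that contains a square root of -1. *)
Definition re_expi (n : nat) : int := nth 0 [:: 1; 0; -1; 0] (n %% 4).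
Definition im_expi (n : nat) : int := nth 0 [:: 0; 1; 0; -1] (n %% 4).

Lemma exprE_i (R : comNzRingType) (i : R) n : i ^+ 2 = -1 ->
  i ^+ n = (re_expi n)%:~R + (im_expi n)%:~R * i.
Proof.
move=> i2; have i4 : i ^+ 4 = 1 by rewrite (exprM i 2 2) i2 sqrrN expr1n.
rewrite {1}(divn_eq n 4) exprD mulnC exprM i4 expr1n mul1r /re_expi /im_expi.
have := ltn_pmod n (isT : (0 < 4)%N).
case: (n %% 4)%N => [|[|[|[|m]]]] //= _.
- by rewrite mul0r addr0.
- by rewrite mul1r add0r.
- by rewrite i2 mul0r addr0.
- by rewrite exprSr i2 add0r.
Qed.

Section QuarticExponent.
Variables (K : finFieldType) (k : nat) (w : K).
Implicit Types x y : K.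
Hypothesis cardK : #|K| = (4 * k).+1.
Hypothesis w2 : w ^+ 2 = -1.

Lemma two_neq0_card : 2%:R != 0 :> K.
Proof.
apply/eqP => K20; have := card_finField0 K.
rewrite cardK -addn1 natrD (mulnDl 2 2) -mulnDr natrM K20 mul0r add0r.
exact/eqP/oner_neq0.
Qed.

Lemma quarter_gt0 : (0 < k)%N.
Proof.
have := max_card (mem [:: 0; 1 : K]).
rewrite (card_uniqP _) /= ?inE ?andbT; last by rewrite eq_sym oner_neq0.
by rewrite cardK; case: k.
Qed.

Lemma w_prim : 4.-primitive_root w. Proof. exact: prim_root_i two_neq0_card w2. Qed.

Lemma w_neq0 : w != 0.
Proof.
by move: w2; apply: contra_eq_neq => ->; rewrite expr0n /= eq_sym oppr_eq0 oner_neq0.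
Qed.

(** The exponent of the quartic residue symbol of x, as an integer in
    0, ..., 3.  Storing the exponent rather than the symbol makes it possible
    to compare symbols for different primes and to give them values in any
    field. *)
Definition qindex (x : K) : nat := index (x ^+ k) [:: 1; w; w ^+ 2; w ^+ 3].

Lemma expf4k x : x != 0 -> x ^+ (4 * k) = 1.
Proof. by move=> /expf_card_pred; rewrite cardK. Qed.

(** x^k is a root of X^4 - 1, which splits over the powers of w. *)
Lemma expfk_mem x : x != 0 -> x ^+ k \in [:: 1; w; w ^+ 2; w ^+ 3].
Proof.
move=> x0; have := expf4k x0; rewrite mulnC exprM !inE.
move: (x ^+ k) => y y4.
have : (y - 1) * ((y - w) * ((y - w ^+ 2) * (y - w ^+ 3))) = 0.
  by rewrite (exprS w 2) w2; ring: w2 y4.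
by move/eqP; rewrite !mulf_eq0 !subr_eq0.
Qed.

Lemma qindex_lt4 x : x != 0 -> (qindex x < 4)%N.
Proof.
by move=> x0; have := expfk_mem x0; rewrite -index_mem.
Qed.

Lemma qindexE x : x != 0 -> w ^+ qindex x = x ^+ k.
Proof.
move=> x0; have := qindex_lt4 x0; have := nth_index 0 (expfk_mem x0).
by rewrite -/(qindex x); case: (qindex x) => [|[|[|[|n]]]].
Qed.

Lemma qindex_eq x n : x != 0 -> x ^+ k = w ^+ n -> qindex x = (n %% 4)%N.
Proof.
move=> x0 xn; rewrite -(modn_small (qindex_lt4 x0)); apply/eqP.
by rewrite -(eq_prim_root_expr w_prim) qindexE // xn.
Qed.

Lemma qindexM x y : x != 0 -> y != 0 -> qindex (x * y) = ((qindex x + qindex y) %% 4)%N.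
Proof.
by move=> x0 y0; apply: qindex_eq; rewrite ?mulf_neq0 // exprMn exprD !qindexE.
Qed.

Lemma qindex1 : qindex 1 = 0%N.
Proof. by rewrite /qindex expr1n /= eqxx. Qed.

Lemma qindexN1 : qindex (-1) = ((2 * k) %% 4)%N.
Proof. by apply: qindex_eq; rewrite ?oppr_eq0 ?oner_neq0 // exprM w2. Qed.

Lemma qindexw : qindex w = (k %% 4)%N.
Proof. exact: qindex_eq w_neq0 _. Qed.

Lemma qindexX x n : x != 0 -> qindex (x ^+ n) = ((n * qindex x) %% 4)%N.
Proof.
move=> x0; apply: qindex_eq; first by rewrite expf_neq0.
by rewrite mulnC exprM qindexE // -!exprM mulnC.
Qed.

Lemma ex_generator : exists g : K, (4 * k).-primitive_root g.
Proof. by have := ex_finField_generator K; rewrite cardK. Qed.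

(** A suitable power of a generator of the multiplicative group; it serves
    to show that characters are nontrivial. *)
Lemma ex_qindex1 : exists2 g : K, g != 0 & qindex g = 1%N.
Proof.
have [g gp] := ex_generator.
have [j wE] := prim_rootP (dvdn_prim_root gp (dvdn_mulr k (dvdnn 4)))
  (prim_expr_order w_prim).
have g0 : g != 0 by rewrite (prim_root_eq0 gp) -lt0n muln_gt0 quarter_gt0.
exists (g ^+ j); rewrite ?expf_neq0 // (qindex_eq (n := 1)) ?expf_neq0 //.
by rewrite expr1 wE mulKn // -!exprM mulnC.
Qed.

End QuarticExponent.

(** * The quartic character and its Jacobi sum *)

Section QuarticChar.
Variables (K : finFieldType) (k : nat) (w : K).
Implicit Types x y : K.
Hypothesis cardK : #|K| = (4 * k).+1.
Hypothesis w2 : w ^+ 2 = -1.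
Let e := qindex k w.

(** The a-th power of the quartic character, with values in any field F
    where a square root i of -1 is chosen. *)
Definition quartic_char (F : fieldType) (i : F) (a : nat) (x : K) : F :=
  if x == 0 then 0 else i ^+ (a * e x).

(** With [jacobi_im], the coordinates A and B of the Jacobi sum A + B i of
    the quartic character and the quadratic character. *)
Definition jacobi_re : int :=
  \sum_(x | (x != 0) && (x != 1)) re_expi (e x + 2 * e (1 - x)).
Definition jacobi_im : int :=
  \sum_(x | (x != 0) && (x != 1)) im_expi (e x + 2 * e (1 - x)).

Section CharValues.
Variables (F : fieldType) (i : F).
Hypothesis i2 : i ^+ 2 = -1.

Lemma expi4 : i ^+ 4 = 1.
Proof. by rewrite (exprM i 2 2) i2 sqrrN expr1n. Qed.

Lemma expi_mod n : i ^+ (n %% 4) = i ^+ n.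
Proof. by rewrite expr_mod ?expi4. Qed.

Lemma chi0 a : quartic_char i a 0 = 0. Proof. by rewrite /quartic_char eqxx. Qed.

Lemma chiE a x : x != 0 -> quartic_char i a x = i ^+ (a * e x).
Proof. by rewrite /quartic_char => /negbTE ->. Qed.

Lemma mulchar_chi a : mulchar (quartic_char i a).
Proof.
split; first exact: chi0.
  by rewrite chiE ?oner_neq0 // /e qindex1 muln0.
move=> x y; have [->|x0] := eqVneq x 0; first by rewrite mul0r !chi0 mul0r.
have [->|y0] := eqVneq y 0; first by rewrite mulr0 !chi0 mulr0.
rewrite !chiE ?mulf_neq0 // -exprD -mulnDr /e (qindexM cardK w2) //.
by rewrite -expi_mod modnMmr expi_mod.
Qed.

Lemma chi_add a b x : quartic_char i a x * quartic_char i b x = quartic_char i (a + b) x.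
Proof.
have [->|x0] := eqVneq x 0; first by rewrite !chi0 mul0r.
by rewrite !chiE // -exprD mulnDl.
Qed.

Lemma chi_mod a x : quartic_char i (a %% 4) x = quartic_char i a x.
Proof.
have [->|x0] := eqVneq x 0; first by rewrite !chi0.
by rewrite !chiE // -expi_mod modnMml expi_mod.
Qed.

Lemma chiN1 a : quartic_char i a (-1) = (-1) ^+ (a * k).
Proof.
rewrite chiE ?oppr_eq0 ?oner_neq0 // /e (qindexN1 cardK w2) -expi_mod modnMmr.
by rewrite expi_mod mulnCA exprM i2.
Qed.

(** - i is the cube of i, so changing the sign of i conjugates the
    character. *)
Lemma chi_opp a x : quartic_char (- i) a x = quartic_char i (3 * a) x.
Proof.
have [->|x0] := eqVneq x 0; first by rewrite /quartic_char eqxx.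
rewrite chiE // /quartic_char (negbTE x0) -[- i]mulN1r -i2 -exprSr -exprM.
by rewrite mulnA.
Qed.

Lemma jacobi_chi : jacobi_sum (quartic_char i 1) (quartic_char i 2) =
  jacobi_re%:~R + jacobi_im%:~R * i.
Proof.
rewrite /jacobi_sum /jacobi_re /jacobi_im !rmorph_sum /= mulr_suml -big_split /=.
rewrite [RHS]big_mkcond; apply: eq_bigr => x _.
have [->|x0] := eqVneq x 0; first by rewrite chi0 mul0r.
have [->|x1] := eqVneq x 1; first by rewrite subrr chi0 mulr0.
rewrite !chiE //; last by rewrite subr_eq0 eq_sym.
by rewrite -exprD mul1n (exprE_i _ i2).
Qed.
End CharValues.

Lemma jacobi_chi_conj (F : fieldType) (i : F) : i ^+ 2 = -1 ->
  jacobi_sum (quartic_char i 3) (quartic_char i 2) = jacobi_re%:~R - jacobi_im%:~R * i.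
Proof.
move=> i2; rewrite -mulrN -jacobi_chi ?sqrrN //; apply: eq_bigr => x _.
by rewrite !chi_opp // -(chi_mod i2 (3 * 2)).
Qed.

Section GaussRelations.
Variables (F : fieldType) (i : F) (psi : K -> F).
Hypothesis i2 : i ^+ 2 = -1.
Hypothesis F2 : 2%:R != 0 :> F.
Hypothesis psiD : forall x y, psi (x + y) = psi x * psi y.
Hypothesis psi0 : psi 0 = 1.
Hypothesis psi_nt : exists a, psi a != 1.

Let G a := gauss_sum psi (quartic_char i a).
Let p : F := #|K|%:R.
Let J : F := jacobi_re%:~R + jacobi_im%:~R * i.
Let J' : F := jacobi_re%:~R - jacobi_im%:~R * i.

Lemma chi_nontrivial a : ~~ (4 %| a)%N -> exists2 g, g != 0 & quartic_char i a g != 1.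
Proof.
move=> a4; have [g g0 g1] := ex_qindex1 cardK w2; exists g => //.
by rewrite chiE // /e g1 muln1 -(prim_order_dvd (prim_root_i F2 i2)).
Qed.

Lemma gauss_chiM a b : ~~ (4 %| a + b)%N ->
  G a * G b = jacobi_sum (quartic_char i a) (quartic_char i b) * G (a + b).
Proof.
move=> ab; have [g g0 g1] := chi_nontrivial ab.
rewrite /G (gauss_sumM psiD (mulchar_chi i2 a) (mulchar_chi i2 b) g0).
  by congr (_ * _); apply: eq_bigr => x _; rewrite chi_add.
by rewrite chi_add.
Qed.

Lemma gauss_chi_mod a : G (a %% 4) = G a.
Proof. by apply: eq_bigr => x _; rewrite chi_mod. Qed.

Lemma gauss_chiMV a b : ~~ (4 %| b)%N -> (4 %| a + b)%N ->
  G a * G b = (-1) ^+ (b * k) * p.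
Proof.
move=> b4 ab; have [g g0 g1] := chi_nontrivial b4.
rewrite /G (gauss_sumMV psiD psi0 psi_nt (mulchar_chi i2 a) (mulchar_chi i2 b) g0 g1).
  by rewrite chiN1.
move=> x x0; rewrite chi_add -chi_mod // (eqP ab).
by rewrite chiE // mul0n.
Qed.

(** The square of the quadratic Gauss sum is p, without sign because
    p = 1 mod 4. *)
Lemma gauss_rho_sqr : G 2 ^+ 2 = p.
Proof. by rewrite expr2 gauss_chiMV // exprM sqrrN expr1n expr1n mul1r. Qed.

Lemma gauss_13 : G 1 * G 3 = (-1) ^+ k * p.
Proof. by rewrite gauss_chiMV // exprM exprS sqrrN expr1n mulr1. Qed.

Lemma gauss_12 : G 1 * G 2 = J * G 3.
Proof. by rewrite gauss_chiM // jacobi_chi. Qed.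

Lemma gauss_32 : G 3 * G 2 = J' * G 1.
Proof. by rewrite gauss_chiM // -(gauss_chi_mod (3 + 2)) jacobi_chi_conj. Qed.

Hypothesis p0 : p != 0.

Lemma gauss_neq0 : (G 1 != 0) && (G 3 != 0).
Proof.
have : G 1 * G 3 != 0 by rewrite gauss_13 mulf_neq0 // signr_eq0.
by rewrite mulf_eq0 negb_or.
Qed.

(** Multiply [gauss_12] and [gauss_32], cancel the product of the two
    quartic Gauss sums, and use that G 2 squares to p. *)
Lemma jacobi_norm : J * J' = p.
Proof.
have /andP[G1 G3] := gauss_neq0; apply: (mulIf (mulf_neq0 G3 G1)).
by rewrite mulrACA -gauss_12 -gauss_32 -gauss_rho_sqr; ring.
Qed.

(** From G 1 * G 2 = J * G 3 and G 1 * G 3 = (-1)^k p, the product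
    G 1 ^+ 2 * G 2 is (-1)^k J p; it remains to square. *)
Lemma gauss_pow4 : G 1 ^+ 4 = J ^+ 2 * p.
Proof.
apply: (mulIf p0); rewrite -{1}gauss_rho_sqr.
have -> : G 1 ^+ 4 * G 2 ^+ 2 = (G 1 * (G 1 * G 2)) ^+ 2 by ring.
rewrite gauss_12 mulrCA gauss_13 !exprMn -exprM mulnC exprM sqrrN !expr1n.
ring.
Qed.

End GaussRelations.

Lemma chi_wK x : quartic_char w 1 x = x ^+ k.
Proof.
rewrite /quartic_char; case: eqVneq => [->|x0].
  by rewrite expr0n -[_ == _]negbK -lt0n (quarter_gt0 cardK).
by rewrite mul1n /e (qindexE cardK w2).
Qed.

(** x |-> x^m is a nontrivial multiplicative character with values in K
    itself. *)
Lemma power_sum0 m : (0 < m < 4 * k)%N -> \sum_(x : K) x ^+ m = 0.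
Proof.
move=> /andP[m0 mk]; have [g gp] := ex_generator cardK.
apply: (@sum_mulchar _ _ (fun x : K => x ^+ m) g).
- split; [by rewrite expr0n gtn_eqF | by rewrite expr1n |].
  by move=> x y; rewrite exprMn.
- by rewrite (prim_root_eq0 gp) -lt0n muln_gt0 (quarter_gt0 cardK).
- by rewrite -(prim_order_dvd gp) gtnNdvd.
Qed.

(** Read in K with i = w, the quartic character is x |-> x^k, so the Jacobi
    sum is a sum of values of a polynomial without constant term of degree
    3k < #|K| - 1, and each of its monomials sums to 0. *)
Lemma jacobi_K : jacobi_re%:~R + jacobi_im%:~R * w = 0.
Proof.
rewrite -jacobi_chi //.
transitivity (\sum_(x : K) x ^+ k * (1 - x) ^+ (2 * k)).
  apply: eq_bigr => x _; rewrite -(chi_add w 1 1) !chi_wK mulnC exprM.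
  by rewrite expr2.
under eq_bigr do rewrite exprDn mulr_sumr.
rewrite exchange_big /= big1 // => j _.
have k0 := quarter_gt0 cardK; have j2k := ltn_ord j.
transitivity ((\sum_(x : K) x ^+ (k + j)) * ((-1) ^+ j *+ 'C(2 * k, j)) : K).
  rewrite mulr_suml; apply: eq_bigr => x _.
  by rewrite expr1n mul1r [(- x) ^+ j]exprNn exprD -mulrnAl mulrA mulrAC.
by rewrite power_sum0 ?mul0r //; lia.
Qed.

End QuarticChar.

Section Primary.
Variables (K : finFieldType) (k : nat) (w : K).
Implicit Types x y : K.
Hypothesis cardK : #|K| = (4 * k).+1.
Hypothesis w2 : w ^+ 2 = -1.
Let e := qindex k w.

(** Multiplication by an element of index m permutes the nonzero elements
    and, by assumption, changes the sign of every term. *)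
Lemma sum_qindex0 (f : nat -> int) m :
  (forall n, (n < 4)%N -> f ((m + n) %% 4)%N = - f n) ->
  \sum_(x : K | x != 0) f (e x) = 0.
Proof.
move=> fm; have [g g0 g1] := ex_qindex1 cardK w2.
have gm0 : g ^+ m != 0 by rewrite expf_neq0.
suff: \sum_(x : K | x != 0) f (e x) = - \sum_(x : K | x != 0) f (e x) by lia.
rewrite {1}(reindex_inj (mulfI gm0)) /= -sumrN.
rewrite (eq_bigl (fun x : K => x != 0)) => [|x]; last by rewrite mulf_eq0 (negbTE gm0).
apply: eq_bigr => x x0; rewrite -fm ?(qindex_lt4 cardK) // /e (qindexM cardK w2) //.
by rewrite (qindexX cardK w2) // g1 muln1 modnDml.
Qed.

Lemma card_qindex_odd : \sum_(x : K | x != 0) (odd (e x))%:R = (2 * k)%:Z.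
Proof.
have : (\sum_(x : K | x != 0) (1 - 2 * (odd (e x))%:R : int))%R = 0.
  apply: (@sum_qindex0 (fun n => 1 - 2 * (odd n)%:R) 1%N).
  by case=> [|[|[|[|n]]]].
rewrite sumrB -mulr_sumr sumr_const.
have -> : #|(fun x : K => x != 0)| = (4 * k)%N.
  by have := cardC (pred1 (0 : K)); rewrite card1 cardK add1n => -[].
rewrite natz; move: (\sum_(i | _) _) => S; lia.
Qed.

(** The form of i^(2b) = (-1)^b = 1 - 2 [b odd] in which the factor 2 stays
    visible, for use in the congruence [jacobi_primary]. *)
Lemma re_expiD2 a b : re_expi (a + 2 * b) = re_expi a - 2 * ((odd b)%:R * re_expi a).
Proof.
have -> : re_expi (a + 2 * b) = re_expi (a + 2 * odd b).
  by rewrite /re_expi; congr (nth _ _ _); lia.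
case: (odd b); rewrite ?muln0 ?addn0 ?mul0r ?mulr0 ?subr0 // mul1r /re_expi -modnDml.
by have := ltn_pmod a (isT : (0 < 4)%N); case: (a %% 4)%N => [|[|[|[|]]]].
Qed.

Lemma im_expiD2 a b : im_expi (a + 2 * b) = im_expi a - 2 * ((odd b)%:R * im_expi a).
Proof.
have -> : im_expi (a + 2 * b) = im_expi (a + 2 * odd b).
  by rewrite /im_expi; congr (nth _ _ _); lia.
case: (odd b); rewrite ?muln0 ?addn0 ?mul0r ?mulr0 ?subr0 // mul1r /im_expi -modnDml.
by have := ltn_pmod a (isT : (0 < 4)%N); case: (a %% 4)%N => [|[|[|[|]]]].
Qed.

Lemma expi_re_im_sum n : re_expi n + im_expi n = 1 - 2 * (1 < n %% 4)%N%:R.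
Proof.
rewrite /re_expi /im_expi; have := ltn_pmod n (isT : (0 < 4)%N).
by case: (n %% 4)%N => [|[|[|[|]]]].
Qed.

Lemma sum_neq01 (f : nat -> int) : f 0%N + \sum_(x : K | (x != 0) && (x != 1)) f (e x) =
  \sum_(x : K | x != 0) f (e x).
Proof. by rewrite [RHS](bigD1 1) ?oner_neq0 //= /e qindex1. Qed.

(** This is the congruence J = -1 mod 2+2i.  Replacing the quadratic
    character by its difference with 1 leaves -1 (the missing term x = 1) minus
    2 times the sum of chi(x) over the x for which 1 - x is a nonresidue.  Each
    chi(x) is 1 mod 1+i, and there are 2k such x, an even number. *)
Lemma jacobi_primary : exists z v : int,
  jacobi_re k w + jacobi_im k w = 4 * z - 1 /\ jacobi_im k w = 2 * v.
Proof.
pose u : int := \sum_(x : K | (x != 0) && (x != 1)) (odd (e (1 - x)))%:R * re_expi (e x).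
pose v : int := \sum_(x : K | (x != 0) && (x != 1)) (odd (e (1 - x)))%:R * im_expi (e x).
have EA : jacobi_re k w = -1 - 2 * u.
  rewrite /jacobi_re; under eq_bigr do rewrite re_expiD2.
  rewrite sumrB -mulr_sumr; congr (_ - _).
  have := sum_neq01 re_expi; rewrite (@sum_qindex0 re_expi 2) /re_expi //= => [|].
    by move=> H; apply: (addrI 1); rewrite H.
  by case=> [|[|[|[|n]]]].
have EB : jacobi_im k w = - 2 * v.
  rewrite /jacobi_im; under eq_bigr do rewrite im_expiD2.
  rewrite sumrB -mulr_sumr mulNr; rewrite [X in X - _ = _](_ : _ = 0) ?sub0r //.
  have := sum_neq01 im_expi; rewrite (@sum_qindex0 im_expi 2) /im_expi //= => [|].
    by rewrite add0r.
  by case=> [|[|[|[|n]]]].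
(* C counts the terms of u + v equal to -1 rather than 1. *)
pose C : int := \sum_(x : K | (x != 0) && (x != 1))
  ((odd (e (1 - x)))%:R * (1 < e x %% 4)%N%:R).
have uv : u + v = (2 * k)%:Z - 2 * C.
  rewrite -card_qindex_odd /u /v /C -big_split mulr_sumr /=.
  rewrite [X in _ = X - _](reindex_inj (inv_inj (subKr 1))) /=.
  rewrite [X in _ = X - _](bigD1 0) ?subr0 ?oner_neq0 //= [e 1]qindex1 add0r.
  rewrite [X in _ = X - _](eq_bigl (fun x : K => (x != 0) && (x != 1))) => [|x].
    by rewrite -sumrB; apply: eq_bigr => x _; rewrite -mulrDr expi_re_im_sum; ring.
  by rewrite subr_eq0 eq_sym andbC.
by exists (C - k%:Z), (- v); lia.
Qed.

End Primary.

(** * Reciprocity through the Frobenius map *)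

Section FrobeniusFormulas.
Variables (K : finFieldType) (k : nat) (w : K).
Implicit Types x y : K.
Hypothesis cardK : #|K| = (4 * k).+1.
Hypothesis w2 : w ^+ 2 = -1.
Let e := qindex k w.
Variables (F : fieldType) (i : F) (psi : K -> F).
Hypothesis i2 : i ^+ 2 = -1.
Hypothesis F2 : 2%:R != 0 :> F.
Hypothesis psiD : forall x y, psi (x + y) = psi x * psi y.
Hypothesis psi0 : psi 0 = 1.
Hypothesis psi_nt : exists a, psi a != 1.
Hypothesis p0 : #|K|%:R != 0 :> F.
Variable q : nat.
Hypothesis charF : q \in [pchar F].
Hypothesis q0 : q%:R != 0 :> K.

Let G a := gauss_sum psi (quartic_char k w i a).
Let p : F := #|K|%:R.
Let J : F := (jacobi_re k w)%:~R + (jacobi_im k w)%:~R * i.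

(** In characteristic q the q-th power is additive, so G^q is the sum of
    the q-th powers of the terms; as psi(x)^q = psi(q x), the substitution
    x -> x/q brings it back to a Gauss sum. *)
Lemma gauss_frobenius a : quartic_char k w i (a * q) q%:R * G a ^+ q = G (a * q).
Proof.
have psiM x n : psi (x *+ n) = psi x ^+ n.
  by elim: n => [|n IH]; rewrite ?mulr0n ?psi0 // mulrS exprS psiD IH.
have -> : G a ^+ q = \sum_x quartic_char k w i (a * q) x * psi (q%:R * x).
  rewrite -(pFrobenius_autE charF) rmorph_sum /=; apply: eq_bigr => x _.
  rewrite pFrobenius_autE exprMn mulr_natl psiM; congr (_ * _).
  rewrite /quartic_char; case: eqP => _; last by rewrite -exprM mulnAC.
  by rewrite expr0n gtn_eqF // prime_gt0 // (pcharf_prime charF).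
have mc := mulchar_chi cardK w2 i2 (a * q).
rewrite (gauss_sum_scale _ mc q0) (mulcharV mc q0) mulVKf //.
by rewrite (mulchar_neq0 mc).
Qed.

(** Two evaluations of G^q: [gauss_frobenius], and (G^4)^m G with
    G^4 = J^2 p. *)
Lemma quartic_residue1 m : q = (4 * m + 1)%N -> i ^+ e q%:R * (J ^+ 2 * p) ^+ m = 1.
Proof.
move=> qE; have /andP[G1 _] := gauss_neq0 cardK w2 i2 F2 psiD psi0 psi_nt p0.
have Gq : G 1 ^+ q = (J ^+ 2 * p) ^+ m * G 1.
  by rewrite qE exprD expr1 exprM (gauss_pow4 cardK w2 i2 F2 psiD psi0 psi_nt p0).
have := gauss_frobenius 1; rewrite mul1n Gq.
have -> : G q = G 1 by rewrite /G -(gauss_chi_mod _ _ _ i2) qE; congr G; lia.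
rewrite -(chi_mod _ _ i2) (_ : q %% 4 = 1)%N; last by lia.
by rewrite mulrA -[RHS]mul1r => /(mulIf G1); rewrite chiE // mul1n.
Qed.

(** As in [quartic_residue1], but now the Frobenius map turns chi into its
    conjugate, so the relation is multiplied by G in order to use
    G 1 * G 3 = (-1)^k p. *)
Lemma quartic_residue3 m : q = (4 * m + 3)%N ->
  (J ^+ 2 * p) ^+ m.+1 = i ^+ e q%:R * ((-1) ^+ k * p).
Proof.
move=> qE; have /andP[G1 _] := gauss_neq0 cardK w2 i2 F2 psiD psi0 psi_nt p0.
have := gauss_frobenius 1; rewrite mul1n.
have -> : G q = G 3 by rewrite /G -(gauss_chi_mod _ _ _ i2) qE; congr G; lia.
rewrite -(chi_mod _ _ i2) (_ : q %% 4 = 3)%N; last by lia.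
have G13 : G 1 * G 3 = (-1) ^+ k * p := gauss_13 cardK w2 i2 F2 psiD psi0 psi_nt.
have G4 : G 1 ^+ 4 = J ^+ 2 * p := gauss_pow4 cardK w2 i2 F2 psiD psi0 psi_nt p0.
rewrite -G13 -G4 -exprM => <-.
rewrite (_ : 4 * m.+1 = q.+1)%N; last by lia.
rewrite chiE // -/e exprS -[LHS]mul1r.
have <- : i ^+ e q%:R * i ^+ (3 * e q%:R) = 1.
  by rewrite -exprD -mulSn exprM expi4 // expr1n.
by ring.
Qed.

(** The quadratic reciprocity law for a prime p = 1 mod 4, proved by the
    same comparison for the quadratic Gauss sum. *)
Lemma quadratic_residue m : q = (2 * m + 1)%N -> p ^+ m = (-1) ^+ e q%:R.
Proof.
move=> qE; have := gauss_frobenius 2.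
have := gauss_rho_sqr cardK w2 i2 F2 psiD psi0 psi_nt; rewrite -/(G 2) -/p => G2.
have G20 : G 2 != 0 by apply: contraNneq p0 => G20; rewrite -/p -G2 G20 expr0n.
have -> : G (2 * q) = G 2 by rewrite /G -(gauss_chi_mod _ _ _ i2) qE; congr G; lia.
rewrite -(chi_mod _ _ i2) (_ : 2 * q %% 4 = 2)%N; last by lia.
have -> : G 2 ^+ q = p ^+ m * G 2 by rewrite qE exprD expr1 exprM G2.
rewrite mulrA -[RHS]mul1r => /(mulIf G20).
rewrite chiE // exprM i2 => H.
by apply: (mulfI (_ : (-1) ^+ e q%:R != 0)); rewrite ?signr_eq0 ?H -?expr2 ?sqrr_sign.
Qed.

End FrobeniusFormulas.

(** * Counting points on y^2 = x^3 + D x *)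

Lemma card_sqrt_sqr (K : finFieldType) (y : K) : 2%:R != 0 :> K -> y != 0 ->
  #|[pred x : K | x ^+ 2 == y ^+ 2]| = 2%N.
Proof.
move=> K2 y0; have /eq_card -> : [pred x | x ^+ 2 == y ^+ 2] =i [:: y; - y].
  by move=> x; rewrite !inE eqf_sqr.
rewrite (card_uniqP _) //= inE andbT -subr_eq0 opprK -mulr2n -mulr_natl.
by rewrite mulf_neq0.
Qed.

Lemma card_plane_curve (K : finFieldType) (f : K -> K) :
  #|[pred P : K * K | P.2 ^+ 2 == f P.1]| =
  (\sum_x #|[pred y : K | y ^+ 2 == f x]|)%N.
Proof.
under [RHS]eq_bigr do rewrite -sum1_card big_mkcond /=.
by rewrite -sum1_card big_mkcond pair_big.
Qed.

(** When #|K| = 3 mod 4, -1 is not a square, so for c != 0 exactly one of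
    c and - c is: indeed (c^(k+1))^2 = c * c^(2k+1), and c^(2k+1) is 1 or -1. *)
Lemma card_sqrt_opp (K : finFieldType) (k : nat) (c : K) : #|K| = (4 * k + 3)%N ->
  (#|[pred y : K | y ^+ 2 == c]| + #|[pred y : K | y ^+ 2 == - c]| = 2)%N.
Proof.
move=> cK; have x1 (x : K) : x != 0 -> x ^+ (2 * (2 * k).+1) = 1.
  by move=> x0; rewrite -(expf_card_pred x0) cK; congr (x ^+ _); lia.
have K2 : 2%:R != 0 :> K.
  apply/eqP => K20; have := card_finField0 K.
  rewrite cK (_ : 4 * k + 3 = 2 * (2 * k + 1) + 1)%N; last by lia.
  by rewrite natrD natrM K20 mul0r add0r => /eqP; rewrite oner_eq0.
have [->|c0] := eqVneq c 0.
  have E : [pred y : K | y ^+ 2 == 0] =i pred1 0 by move=> y; rewrite !inE expf_eq0.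
  by rewrite oppr0 (eq_card E) card1.
wlog c1 : c c0 / c ^+ (2 * k).+1 = 1 => [IH|].
  have : (c ^+ (2 * k).+1 == 1) || (c ^+ (2 * k).+1 == -1).
    by rewrite -eqf_sqr expr1n -exprM mulnC x1.
  case/orP => /eqP c1; first exact: IH.
  rewrite addnC -{2}[c]opprK; apply: IH; rewrite ?oppr_eq0 //.
  by rewrite exprNn c1 exprS exprM sqrrN !expr1n mulr1 mulrNN mulr1.
have cE : c = (c ^+ k.+1) ^+ 2.
  by rewrite -exprM (_ : k.+1 * 2 = (2 * k).+2)%N; [rewrite exprS c1 mulr1 | lia].
rewrite [X in (_ + X)%N]eq_card0 => [|y].
  by rewrite addn0 {1}cE card_sqrt_sqr // expf_neq0.
rewrite !inE; apply/negP => /eqP yc.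
have y0 : y != 0.
  by move: c0; apply: contra_neq => y0; rewrite -[c]opprK -yc y0 expr0n oppr0.
have := x1 _ y0; rewrite exprM yc exprNn c1 mulr1 exprS exprM sqrrN !expr1n mulr1.
by move/eqP; rewrite eq_sym -subr_eq0 opprK -[1 + 1]/(2%:R) (negbTE K2).
Qed.

(** The polynomial x^3 + D x is odd, so the fibres over x and - x
    together have two points. *)
Lemma curve_card_3mod4 (K : finFieldType) (k : nat) (D : K) :
  #|K| = (4 * k + 3)%N -> 
  #|[pred P : K * K | P.2 ^+ 2 == P.1 ^+ 3 + D * P.1]| = #|K|.
Proof.
move=> cK; rewrite (card_plane_curve (fun x => x ^+ 3 + D * x)).
set n := fun c => #|[pred y : K | y ^+ 2 == c]|; set f := fun x => x ^+ 3 + D * x.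
suff : (2 * \sum_x n (f x) = 2 * #|K|)%N by rewrite /n /f; lia.
rewrite mulSn mul1n {2}(reindex_inj (@oppr_inj K)) -big_split /=.
rewrite (eq_bigr (fun=> 2%N)) => [|x _]; first by rewrite sum_nat_const cardT -cardE mulnC.
rewrite -(card_sqrt_opp (f x) cK) /n; congr (_ + #|_|)%N.
by rewrite /f (_ : (- x) ^+ 3 + D * - x = - (x ^+ 3 + D * x)) //; ring.
Qed.

Section CurveCard.
Variables (K : finFieldType) (k : nat) (w : K).
Implicit Types x y : K.
Hypothesis cardK : #|K| = (4 * k).+1.
Hypothesis w2 : w ^+ 2 = -1.
Let e := qindex k w.
Variables (F : fieldType) (i : F).
Hypothesis i2 : i ^+ 2 = -1.
Hypothesis F2 : 2%:R != 0 :> F.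

(** The converse direction, that an element of even index is a square, is
    seen on its exponent with respect to a generator. *)
Lemma card_sqrt t : #|[pred x : K | x ^+ 2 == t]|%:R = 1 + quartic_char k w i 2 t.
Proof.
have [->|t0] := eqVneq t 0.
  rewrite chi0 addr0 (eq_card (B := pred1 0)) ?card1 // => x.
  by rewrite !inE expf_eq0.
rewrite chiE // exprM i2 -signr_odd; have K2 := two_neq0_card cardK.
have [et|et] := boolP (odd (qindex k w t)).
  rewrite eq_card0 ?subrr // => x; rewrite !inE; apply/eqP => xt.
  have x0 : x != 0 by apply: contraNneq t0 => x0; rewrite -xt x0 expr0n.
  by move: et; rewrite -xt (qindexX cardK w2) //; lia.
have [g gp] := ex_generator cardK.
have [j tE] := prim_rootP gp (expf4k cardK t0).
have t2k : t ^+ (2 * k) = 1.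
  rewrite mulnC exprM -(qindexE cardK w2) // -exprM mulnC exprM w2.
  by rewrite -signr_odd (negbTE et).
have : (2 * (2 * k) %| j * (2 * k))%N.
  by rewrite mulnA (prim_order_dvd gp) exprM -tE t2k.
have k0 := quarter_gt0 cardK.
rewrite dvdn_pmul2r ?muln_gt0 //.
case/dvdnP => l jE; rewrite tE jE exprM card_sqrt_sqr //.
by rewrite expf_neq0 // (prim_root_eq0 gp) -lt0n muln_gt0 k0.
Qed.

(** Since chi^2(x) = chi(x^2), the sum depends on t = x^2 only, each t being
    hit 1 + chi^2(t) times; substituting t -> - D t then produces the Jacobi
    sum and its conjugate, twisted by the values of chi at D. *)
Lemma curve_char_sum (D : K) : D != 0 ->
  \sum_x quartic_char k w i 2 (x ^+ 3 + D * x) =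
  (-1) ^+ k * 2 * ((re_expi (e D))%:~R * (jacobi_re k w)%:~R +
                   (im_expi (e D))%:~R * (jacobi_im k w)%:~R).
Proof.
move=> D0.
pose h t := quartic_char k w i 1 t * quartic_char k w i 2 (t + D).
have cM a := let: And3 _ _ cM := mulchar_chi cardK w2 i2 a in cM.
transitivity (\sum_(x : K) h (x ^+ 2)).
  apply: eq_bigr => x _; rewrite /h expr2 cM chi_add -cM; congr quartic_char; ring.
transitivity (\sum_t (1 + quartic_char k w i 2 t) * h t).
  rewrite (partition_big (fun x : K => x ^+ 2) xpredT) //=; apply: eq_bigr => t _.
  rewrite -card_sqrt mulr_natl -sumr_const; apply: eq_big => [x|x /eqP ->//].
  by rewrite inE.
transitivity (\sum_t (quartic_char k w i 1 t * quartic_char k w i 2 (t + D) +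
                      quartic_char k w i 3 t * quartic_char k w i 2 (t + D))).
  by apply: eq_bigr => t _; rewrite /h mulrDl mul1r mulrA chi_add.
have mD0 : - D != 0 by rewrite oppr_eq0.
have sumE a : \sum_t (quartic_char k w i a t * quartic_char k w i 2 (t + D)) =
    (-1) ^+ (a * k) * quartic_char k w i (a + 2) D *
    jacobi_sum (quartic_char k w i a) (quartic_char k w i 2).
  rewrite (reindex_inj (mulfI mD0)) /= /jacobi_sum mulr_sumr.
  apply: eq_bigr => t _; rewrite -[- D]mulN1r.
  rewrite (_ : -1 * D * t + D = D * (1 - t)); last by ring.
  by rewrite !cM chiN1 // -chi_add; ring.
rewrite big_split /= !sumE jacobi_chi // jacobi_chi_conj //.
rewrite -(chi_mod _ _ i2 (3 + 2)) !chiE // !mul1n mulnC exprM -/e.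
have i3 : i ^+ e D ^+ (1 + 2) = (re_expi (e D))%:~R - (im_expi (e D))%:~R * i.
  rewrite -mulrN -exprE_i ?sqrrN // -exprM mulnC exprM; congr (_ ^+ _).
  by rewrite exprS i2 mulrN1.
rewrite i3 (exprM _ 3) (_ : (-1) ^+ 3 = -1) ?(exprE_i (e D) i2); last by ring.
by ring: i2.
Qed.

Lemma curve_card_1mod4 (D : K) : D != 0 ->
  #|[pred P : K * K | P.2 ^+ 2 == P.1 ^+ 3 + D * P.1]|%:R = #|K|%:R +
  (-1) ^+ k * 2 * ((re_expi (e D))%:~R * (jacobi_re k w)%:~R +
                   (im_expi (e D))%:~R * (jacobi_im k w)%:~R) :> F.
Proof.
move=> D0; rewrite (card_plane_curve (fun x => x ^+ 3 + D * x)) natr_sum.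
under eq_bigr do rewrite card_sqrt.
by rewrite big_split /= sumr_const curve_char_sum // cardT -cardE.
Qed.

End CurveCard.

(** * Primes that are sums of two squares *)

(** The field with l^m elements for m = totient n: by Euler's theorem n
    divides the order of its multiplicative group, which is cyclic. *)
Lemma ex_finField_prim_root (l n : nat) : prime l -> coprime l n ->
  exists2 F : finFieldType, l \in [pchar F] & exists z : F, n.-primitive_root z.
Proof.
move=> lP ln; have n0 : (0 < n)%N.
  by move: ln; case: n => //; rewrite /coprime gcdn0; case: l lP => [|[|]].
have t0 : (0 < totient n)%N by rewrite totient_gt0.
have [F lF cF] := PrimePowerField lP t0; exists F => //.
have nF : (n %| #|F|.-1)%N.
  rewrite cF -subn1 -eqn_mod_dvd ?expn_gt0 ?prime_gt0 //.
  exact/eqP/cyclic.Euler_exp_totient.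
have [g gp] := ex_finField_generator F.
by exists (g ^+ (#|F|.-1 %/ n)); have := dvdn_prim_root gp nF.
Qed.

Section PrimeFieldCharacter.
Variables (p : nat) (F : fieldType) (z : F).
Hypothesis pP : prime p.
Hypothesis zp : p.-primitive_root z.

Definition Fp_addchar (x : 'F_p) : F := z ^+ (x : nat).

Lemma Fp_addcharD x y : Fp_addchar (x + y) = Fp_addchar x * Fp_addchar y.
Proof.
have zmod n : z ^+ (n %% (Zp_trunc (pdiv p)).+2) = z ^+ n.
  by rewrite Fp_cast // expr_mod ?(prim_expr_order zp).
by rewrite /Fp_addchar -exprD -[RHS]zmod.
Qed.

Lemma Fp_addchar0 : Fp_addchar 0 = 1. Proof. by []. Qed.

Lemma Fp_addchar_nontrivial : exists x, Fp_addchar x != 1.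
Proof.
exists 1; rewrite /Fp_addchar expr1; apply/eqP => z1.
have := prim_order_dvd zp 1; rewrite expr1 z1 eqxx => /dvdn_leq.
by move=> /(_ isT); rewrite leqNgt prime_gt1.
Qed.

End PrimeFieldCharacter.

Lemma cardFp (p k : nat) : prime p -> p = (4 * k).+1 -> #|'F_p| = (4 * k).+1.
Proof. by move=> pP pk; rewrite card_Fp. Qed.

(** An instance of [jacobi_norm] over the complex algebraic numbers, where
    integers can be recovered from their images. *)
Lemma jacobi_norm_int (p k : nat) (w : 'F_p) : prime p -> p = (4 * k).+1 ->
  w ^+ 2 = -1 -> jacobi_re k w ^+ 2 + jacobi_im k w ^+ 2 = p%:Z.
Proof.
move=> pP pk w2; have [z zp] := C_prim_root_exists (prime_gt0 pP).
have i2 := sqrCi algC.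
have C2 : 2%:R != 0 :> algC by rewrite pnatr_eq0.
have := jacobi_norm (cardFp pP pk) w2 i2 C2 (Fp_addcharD pP zp)
  (Fp_addchar0 p z) (Fp_addchar_nontrivial pP zp).
rewrite card_Fp // pnatr_eq0 -lt0n prime_gt0 // => /(_ isT) H.
apply/eqP; rewrite -(eqr_int algC) rmorphD !rmorphXn /=; apply/eqP.
transitivity (((jacobi_re k w)%:~R + (jacobi_im k w)%:~R * 'i) *
              ((jacobi_re k w)%:~R - (jacobi_im k w)%:~R * 'i) : algC).
  by ring: i2.
by rewrite H.
Qed.

Section SumOfTwoSquares.
Variables (p k : nat) (r s : int).
Hypothesis pP : prime p.
Hypothesis pk : p = (4 * k).+1.
Hypothesis prs : p%:Z = r ^+ 2 + s ^+ 2.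

(** The image of i under the reduction Z[i] -> F_p with kernel (r + s i). *)
Definition imag_unit : 'F_p := - (r%:~R / s%:~R).
Let w := imag_unit.
Let A := jacobi_re k w.
Let B := jacobi_im k w.

Lemma intr_Fp_eq0 (n : int) : (n%:~R == 0 :> 'F_p) = (p %| n)%Z.
Proof. by rewrite (dvdz_pcharf (pchar_Fp pP)). Qed.

Lemma Fp_prs : r%:~R ^+ 2 + s%:~R ^+ 2 = 0 :> 'F_p.
Proof.
by rewrite -!rmorphXn -rmorphD /= -prs; apply/eqP; rewrite intr_Fp_eq0 dvdzz.
Qed.

Lemma Fp_neq0 : (r%:~R != 0 :> 'F_p) && (s%:~R != 0 :> 'F_p).
Proof.
have E : (r%:~R == 0 :> 'F_p) = (s%:~R == 0 :> 'F_p).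
  have : r%:~R ^+ 2 == - s%:~R ^+ 2 :> 'F_p by rewrite -addr_eq0 Fp_prs.
  move=> /eqP H; transitivity (r%:~R ^+ 2 == 0 :> 'F_p); first by rewrite expf_eq0.
  by rewrite H oppr_eq0 expf_eq0.
rewrite E andbb intr_Fp_eq0; apply/negP => ps.
have : (p %| r)%Z by rewrite -intr_Fp_eq0 E intr_Fp_eq0.
case/dvdzP: ps => a sE /dvdzP[b rE].
have : p%:Z * (1 - (a ^+ 2 + b ^+ 2) * p%:Z) = 0.
  by rewrite mulrBr mulr1 [X in X - _]prs rE sE; ring.
move/eqP; rewrite mulf_eq0 eqz_nat -[p == 0%N]negbK -lt0n prime_gt0 //=.
rewrite subr_eq0 => /eqP /(congr1 (fun n => `|n|%N)); rewrite abszM /=.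
by move=> /eqP; rewrite eq_sym muln_eq1 => /andP[_ /eqP p1]; move: pP; rewrite p1.
Qed.

Lemma imag_unit_sqr : w ^+ 2 = -1.
Proof.
have /andP[r0 s0] := Fp_neq0; rewrite /w /imag_unit sqrrN expr_div_n.
by apply/eqP; rewrite -subr_eq0 opprK -[X in _ + X](mulfV (expf_neq0 2 s0))
  -mulrDl Fp_prs mul0r.
Qed.

(** A + B i = (n - m i) (r + s i): by [jacobi_K] and the choice of w, p
    divides the imaginary part of (A + B i)(r - s i); that number has norm p^2,
    so p also divides its real part, and the quotient has norm 1. *)
Lemma jacobi_assoc : exists m n : int,
  [/\ m ^+ 2 + n ^+ 2 = 1, A = n * r + m * s & B = n * s - m * r].
Proof.
have p0 : p%:Z != 0 by rewrite eqz_nat -lt0n prime_gt0.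
have N := jacobi_norm_int pP pk imag_unit_sqr; rewrite -/A -/B in N.
have /andP[r0 s0] := Fp_neq0.
have /dvdzP[m mE] : (p %| A * s - B * r)%Z.
  rewrite -intr_Fp_eq0 rmorphB !rmorphM /=.
  have := jacobi_K (cardFp pP pk) imag_unit_sqr; rewrite -/A -/B.
  rewrite /w /imag_unit => /(congr1 ( *%R^~ (s%:~R : 'F_p))); rewrite mul0r => <-.
  by apply/eqP; field.
have E : (A * s - B * r) ^+ 2 + (A * r + B * s) ^+ 2 = p%:Z ^+ 2.
  transitivity ((A ^+ 2 + B ^+ 2) * (r ^+ 2 + s ^+ 2)); first by ring.
  by rewrite N -prs expr2.
have /dvdzP[n nE] : (p %| A * r + B * s)%Z.
  have : (p%:Z %| (A * r + B * s) ^+ 2)%Z.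
    have -> : (A * r + B * s) ^+ 2 = p%:Z * (p%:Z - m ^+ 2 * p%:Z).
      by move: E; rewrite mE => E; rewrite mulrBr -expr2 -E; ring.
    exact: dvdz_mulr.
  by rewrite -!intr_Fp_eq0 rmorphXn /= expf_eq0.
exists m, n; split.
- apply: (mulIf (expf_neq0 2 p0)); rewrite mul1r -[RHS]E mE nE; ring.
- apply: (mulIf p0); rewrite mulrDl [in LHS]prs.
  rewrite (mulrAC n) -nE (mulrAC m) -mE; ring.
- apply: (mulIf p0); rewrite mulrBl [in LHS]prs.
  rewrite (mulrAC n) -nE (mulrAC m) -mE; ring.
Qed.

End SumOfTwoSquares.

(** * The quartic character of 2 *)

Lemma sqr_sum1 (m n : int) : m ^+ 2 + n ^+ 2 = 1 ->
  [\/ (m = 0 /\ n = 1), (m = 0 /\ n = -1), (m = 1 /\ n = 0) | (m = -1 /\ n = 0)].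
Proof.
move=> mn; have m1 : -1 <= m <= 1 by nia.
have n1 : -1 <= n <= 1 by nia.
have : m = -1 \/ m = 0 \/ m = 1 by lia.
have : n = -1 \/ n = 0 \/ n = 1 by lia.
case=> [n0|[n0|n0]]; case=> [m0|[m0|m0]]; move: mn; rewrite n0 m0 // => _.
- by constructor 2.
- by constructor 4.
- by constructor 3.
- by constructor 1.
Qed.

Definition pm3_mod8 (n : nat) : bool := (n %% 8 == 3)%N || (n %% 8 == 5)%N.

Lemma pm3_mod8M a b : odd a -> odd b -> pm3_mod8 (a * b) = pm3_mod8 a (+) pm3_mod8 b.
Proof.
move=> oa ob; rewrite /pm3_mod8 -modnMm.
have : (a %% 8)%N \in [:: 1; 3; 5; 7]%N by rewrite !inE; lia.
have : (b %% 8)%N \in [:: 1; 3; 5; 7]%N by rewrite !inE; lia.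
by rewrite !inE => /or4P[]/eqP-> /or4P[]/eqP->.
Qed.

Lemma pm3_mod8_mod (u v : int) : (8 %| u - v)%Z -> pm3_mod8 `|u| = pm3_mod8 `|v|.
Proof. by move=> uv; rewrite /pm3_mod8; lia. Qed.

Section CharL.
Variables (F : fieldType) (l : nat) (i : F).
Hypothesis charF : l \in [pchar F].

Lemma fermat_int (x : int) : x%:~R != 0 :> F -> x%:~R ^+ l.-1 = 1 :> F.
Proof.
move=> x0; apply: (mulfI x0); rewrite -exprS prednK ?mulr1.
  by rewrite -(pFrobenius_autE charF) rmorph_int.
by rewrite prime_gt0 // (pcharf_prime charF).
Qed.

Lemma two_neq0_pchar : odd l -> 2%:R != 0 :> F.
Proof.
rewrite -(dvdn_pcharf charF) => ol; apply/negP => /(dvdn_leq (isT : (0 < 2)%N)) l2.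
by have := prime_gt1 (pcharf_prime charF); move: l2 ol; case: l => [|[|[|]]].
Qed.

(** The second supplement of quadratic reciprocity.  As (1+i)^2 = 2i, the
    power of 2 is read off from (1+i)^l = 1 + i^l. *)
Lemma two_pow_half : odd l -> i ^+ 2 = -1 -> 2%:R ^+ l./2 = (-1) ^+ pm3_mod8 l :> F.
Proof.
move=> ol i2; have F2 := two_neq0_pchar ol.
have i0 : i != 0 
  by move: i2; apply: contra_eq_neq => ->; rewrite expr0n eq_sym oppr_eq0 oner_eq0.
have E : (1 + i) ^+ 2 = 2 * i by ring: i2.
have i10 : 1 + i != 0.
  have : (1 + i) ^+ 2 != 0 by rewrite E mulf_neq0.
  by rewrite expf_eq0.
have EL : (2 * i) ^+ l./2 * (1 + i) = 1 + i ^+ l.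
  rewrite -E -exprM -exprSr (_ : (2 * l./2).+1 = l); last by lia.
  by rewrite -(pFrobenius_autE charF) rmorphD rmorph1 /= pFrobenius_autE.
have i4 := expi4 i2.
have [l1|l3] : (l = 4 * (l %/ 4) + 1 \/ l = 4 * (l %/ 4) + 3)%N by lia.
  set m := (l %/ 4)%N in l1; have lh : l./2 = (2 * m)%N by lia.
  have -> : pm3_mod8 l = odd m by rewrite /pm3_mod8; lia.
  move: EL; rewrite lh l1 exprD expr1 [i ^+ (4 * _)]exprM i4 expr1n mul1r.
  rewrite -[RHS]mul1r => /(mulIf i10); rewrite exprMn [i ^+ _]exprM i2 => H.
  rewrite signr_odd; apply: (mulIf (_ : (-1) ^+ m != 0)); first by rewrite signr_eq0.
  by rewrite H -expr2 sqrr_sign.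
set m := (l %/ 4)%N in l3; have lh : l./2 = (2 * m).+1 by lia.
have -> : pm3_mod8 l = ~~ odd m by rewrite /pm3_mod8; lia.
have : (2 * i) ^+ l./2 * (1 + i) = - i * (1 + i).
  rewrite EL l3 exprD [i ^+ (4 * _)]exprM i4 expr1n mul1r exprS i2; by ring: i2.
move=> /(mulIf i10); rewrite lh exprMn [i ^+ _]exprS [i ^+ _]exprM i2 => H.
rewrite -oddS signr_odd [(-1) ^+ m.+1]exprS mulN1r; apply: (mulIf i0).
apply: (mulIf (_ : (-1) ^+ m != 0)); first by rewrite signr_eq0.
by rewrite -mulrA H !mulNr mulrAC -expr2 sqrr_sign mul1r.
Qed.
End CharL.


Lemma prim_root4_sqr (F : fieldType) (i : F) : 4.-primitive_root i -> i ^+ 2 = -1.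
Proof.
move=> i4; apply/eqP.
have : (i ^+ 2 == 1) || (i ^+ 2 == -1).
  by rewrite -eqf_sqr expr1n -exprM (prim_expr_order i4).
by rewrite -(prim_order_dvd i4).
Qed.

Lemma odd_prime_neq0 (p l : nat) : prime p -> prime l -> l != p -> l%:R != 0 :> 'F_p.
Proof.
by move=> pP lP lp; rewrite -(dvdn_pcharf (pchar_Fp pP)) dvdn_prime2 // eq_sym.
Qed.

Section ParityOfExponents.
Variables (p k : nat) (r s : int).
Hypothesis pP : prime p.
Hypothesis pk : p = (4 * k).+1.
Hypothesis prs : p%:Z = r ^+ 2 + s ^+ 2.
Let w := imag_unit p r s.
Let e := qindex k w.
Let cardK := cardFp pP pk.
Let w2 : w ^+ 2 = -1 := imag_unit_sqr pP prs.

(** If c p is a nonzero square modulo l, then by reciprocity l has the same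
    quadratic character modulo p as c has modulo l.  Applied with c = 1 to the
    divisors of a leg of p, and with c = 2 to the divisors of r + s. *)
Lemma qindex_prime_parity (l : nat) (c v : int) (b : bool) :
  prime l -> odd l -> ~~ (l %| c * p%:Z)%Z -> (l %| c * p%:Z - v ^+ 2)%Z ->
  (forall (F : fieldType) (i : F), l \in [pchar F] -> i ^+ 2 = -1 ->
     c%:~R ^+ l./2 = (-1) ^+ b :> F) ->
  l%:R != 0 :> 'F_p /\ odd (e l%:R) = b.
Proof.
move=> lP ol lcp lv hc.
have lp : l != p.
  by apply: contraNneq lcp => ->; apply: dvdz_mull.
have l0 := odd_prime_neq0 pP lP lp; split=> //.
have cop : coprime l (4 * p).
  by rewrite coprimeMr prime_coprime // prime_coprime // (dvdn_prime2 lP pP) lp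
    andbT (_ : 4 = 2 ^ 2)%N // Euclid_dvdX // andbT dvdn_prime2 //;
  apply: contraTneq ol => ->.
have [F lF [z zp]] := ex_finField_prim_root lP cop.
have i4 : 4.-primitive_root (z ^+ p).
  by have := dvdn_prim_root zp (dvdn_mulr p (dvdnn 4)); rewrite mulKn.
have zpp : p.-primitive_root (z ^+ 4).
  by have := dvdn_prim_root zp (dvdn_mull 4 (dvdnn p)); rewrite mulnK // prime_gt0.
have i2 := prim_root4_sqr i4; have F2 := two_neq0_pchar lF ol.
have p0 : p%:R != 0 :> F := prim_root_dvd_eq0 zpp (dvdnn p).
have := quadratic_residue cardK w2 i2 F2 (Fp_addcharD pP zpp) (Fp_addchar0 p _)
  (Fp_addchar_nontrivial pP zpp).
rewrite card_Fp // => /(_ p0 l lF l0 l./2).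
have lE : l = (2 * l./2 + 1)%N.
  by rewrite -{1}[l]odd_double_half ol addnC mul2n.
rewrite -lE => /(_ erefl) H; rewrite -/e in H.
have cv : c%:~R * p%:R = v%:~R ^+ 2 :> F.
  apply/eqP; rewrite -subr_eq0 -rmorphXn -[p%:R]/(p%:Z%:~R) -rmorphM -rmorphB /=.
  by rewrite -(dvdz_pcharf lF).
have v0 : v%:~R != 0 :> F.
  have : v%:~R ^+ 2 != 0 :> F.
    by rewrite -cv -[p%:R]/(p%:Z%:~R) -rmorphM /= -(dvdz_pcharf lF).
  by rewrite expf_eq0.
have := fermat_int lF v0; rewrite {1}lE addn1 /= exprM -cv exprMn H (hc F _ lF i2).
move/eqP; rewrite -[_ ^+ e _]signr_odd -signr_addb.
have m1 : -1 != 1 :> F by rewrite eq_sym -subr_eq0 opprK.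
by case: b {hc}; case: (odd _); rewrite ?eqxx //= expr1 (negbTE m1).
Qed.

Lemma qindex_opp_parity (x : 'F_p) : x != 0 -> odd (e (- x)) = odd (e x).
Proof.
move=> x0; rewrite -mulN1r /e (qindexM cardK w2) ?oppr_eq0 ?oner_neq0 //.
by rewrite (qindexN1 cardK w2) odd_mod // oddD odd_mod // oddM.
Qed.

(** Extends a formula for the quadratic character of the prime divisors of u
    to u itself; this replaces the Jacobi symbol. *)
Lemma qindex_odd_parity (theta : nat -> bool) (u : nat) :
  theta 1%N = false ->
  (forall a b, odd a -> odd b -> theta (a * b)%N = theta a (+) theta b) ->
  (forall l, prime l -> odd l -> (l %| u)%N ->
     l%:R != 0 :> 'F_p /\ odd (e l%:R) = theta l) ->
  odd u -> u%:R != 0 :> 'F_p /\ odd (e u%:R) = theta u.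
Proof.
move=> t1 tM; elim/ltn_ind: u => u IH hu ou.
have [u1|u1] := eqVneq u 1%N.
  by rewrite u1 oner_neq0 /e qindex1 t1.
have u2 : (1 < u)%N by move: ou u1; case: u {IH hu} => [|[]].
have lP := pdiv_prime u2; have lu := pdiv_dvd u.
move: (pdiv u) lP lu => l lP /dvdnP[u' uE].
have [ou' ol] : odd u' /\ odd l by apply/andP; rewrite -oddM -uE.
have lu : (l %| u)%N by rewrite uE dvdn_mull.
have [l0 el] := hu l lP ol lu.
have u'u : (u' < u)%N by rewrite uE ltn_Pmulr ?prime_gt1 // odd_gt0.
have hu' q : prime q -> odd q -> (q %| u')%N ->
    q%:R != 0 :> 'F_p /\ odd (e q%:R) = theta q.
  by move=> qP oq qu; apply: hu => //; rewrite uE dvdn_mulr.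
have [u'0 eu'] := IH u' u'u hu' ou'.
rewrite uE natrM mulf_neq0 //; split=> //.
have eM : e (u'%:R * l%:R) = ((e u'%:R + e l%:R) %% 4)%N := qindexM cardK w2 u'0 l0.
by rewrite eM odd_mod // oddD tM //; congr (_ (+) _).
Qed.

Lemma qindex_int_parity (x : int) : x%:~R != 0 :> 'F_p ->
  odd (e x%:~R) = odd (e `|x|%N%:R).
Proof.
case: x => n n0; first by [].
have -> : `|Negz n|%N = n.+1 by [].
move: n0; rewrite NegzE rmorphN /= oppr_eq0 => n0.
exact: (qindex_opp_parity (x := n.+1%:R)).
Qed.

(** p = y^2 modulo every divisor of x, so x is a quadratic residue. *)
Lemma qindex_leg_even (x y : int) : p%:Z = x ^+ 2 + y ^+ 2 -> odd `|x|%N ->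
  odd (e x%:~R) = false.
Proof.
move=> pxy ox; have /andP[x0 _] := Fp_neq0 pP pxy.
rewrite qindex_int_parity //.
have [//|//|l lP ol lx|//|_ ->//] := @qindex_odd_parity xpred0 `|x|%N.
have lx' : (l %| x)%Z by [].
have lp : ~~ (l %| 1 * p%:Z)%Z.
  rewrite mul1r; apply: contraNN x0 => lp; have : (l %| p)%N by [].
  by rewrite dvdn_prime2 // => /eqP lE; rewrite (intr_Fp_eq0 pP) -lE.
apply: (qindex_prime_parity (c := 1) (v := y)) => //.
  by rewrite mul1r pxy addrK dvdz_exp.
by move=> F i _ _; rewrite expr1n expr0.
Qed.

Lemma Fp_sum_sqr : (r + s)%:~R ^+ 2 = 2%:R * (r%:~R * s%:~R) :> 'F_p.
Proof.
have := Fp_prs pP prs; rewrite rmorphD /= => H.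
by rewrite sqrrD addrAC H add0r mulr_natl.
Qed.

Lemma Fp2_neq0 : 2%:R != 0 :> 'F_p. Proof. exact: two_neq0_card cardK. Qed.

Lemma Fp_sum_neq0 : (r + s)%:~R != 0 :> 'F_p.
Proof.
have /andP[r0 s0] := Fp_neq0 pP prs.
have : (r + s)%:~R ^+ 2 != 0 :> 'F_p by rewrite Fp_sum_sqr !mulf_neq0 ?Fp2_neq0.
by rewrite expf_eq0.
Qed.

Lemma odd_sum : odd (absz (r + s)).
Proof.
apply/negPn/negP => even_sum; pose u := ((r + s) %/ 2)%Z.
have sE : s = 2 * u - r by rewrite /u; lia.
have : p%:Z = 2 * (r ^+ 2 - 2 * u * r + 2 * u ^+ 2) by rewrite prs sE; ring.
by rewrite pk; lia.
Qed.

(** 2 p = (r-s)^2 modulo every divisor of r + s. *)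
Lemma qindex_sum_parity : odd (e (r + s)%:~R) = pm3_mod8 (absz (r + s)).
Proof.
rewrite qindex_int_parity ?Fp_sum_neq0 //.
have [//|a b|l lP ol lx||_ ->//] := @qindex_odd_parity pm3_mod8 (absz (r + s)).
- exact: pm3_mod8M.
- have lx' : (l %| r + s)%Z by [].
  have lp : l != p.
    apply: contraNneq Fp_sum_neq0 => lp.
    by rewrite (intr_Fp_eq0 pP) -lp.
  apply: (qindex_prime_parity (c := 2) (v := r - s)) => //.
  + rewrite (_ : (l %| _)%Z = (l %| 2 * p)%N) // Euclid_dvdM // !dvdn_prime2 //.
    by rewrite negb_or lp andbT; apply: contraTneq ol => ->.
  + rewrite prs (_ : _ - _ = (r + s) ^+ 2); last by ring.
    by rewrite dvdz_exp.
  + by move=> F i lF i2; rewrite (two_pow_half lF ol i2).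
- exact: odd_sum.
Qed.

(** Take indices in (r+s)^2 = 2rs = 2 w r^2 = - 2 w s^2: the index of w is
    k, and the index of the odd one among r and s is even. *)
Lemma qindex2 : e 2%:R =
  ((2 * pm3_mod8 (absz (r + s)%R) + (if odd (absz r) then 3 * k else k)) %% 4)%N.
Proof.
have /andP[r0 s0] := Fp_neq0 pP prs.
have eM (x y : 'F_p) : x != 0 -> y != 0 -> e (x * y) = ((e x + e y) %% 4)%N.
  by move=> x0 y0; exact: (qindexM cardK w2 x0 y0).
have eX (x : 'F_p) n : x != 0 -> e (x ^+ n) = ((n * e x) %% 4)%N.
  by move=> x0; exact: (qindexX cardK w2 n x0).
have ew : e w = (k %% 4)%N := qindexw cardK w2.
have eN1 : e (-1) = ((2 * k) %% 4)%N := qindexN1 cardK w2.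
have w0 : w != 0 := w_neq0 w2.
have e24 : (e 2%:R < 4)%N := qindex_lt4 cardK w2 Fp2_neq0.
have H : ((2 * e (r + s)%:~R) %% 4)%N = e (2%:R * (r%:~R * s%:~R)).
  by rewrite -(eX _ 2 Fp_sum_neq0) Fp_sum_sqr.
have rE : r%:~R = - w * s%:~R :> 'F_p by rewrite opprK mulfVK.
have sE : s%:~R = w * r%:~R :> 'F_p.
  by rewrite rE mulrA mulrN -expr2 w2 opprK mul1r.
have := qindex_sum_parity; move: H.
case: ifP => ro.
  have er := qindex_leg_even prs ro.
  rewrite sE (_ : 2%:R * _ = 2%:R * (w * r%:~R ^+ 2)); last by ring.
  rewrite (eM 2%:R) ?Fp2_neq0 ?mulf_neq0 ?expf_neq0 //.
  rewrite (eM w) ?expf_neq0 // (eX _ 2) // ew.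
  move: (e _) (e _) (e _) er e24 => a b c; lia.
have so : odd `|s|%N by move: odd_sum ro; lia.
have es := qindex_leg_even (etrans prs (addrC _ _)) so.
rewrite rE (_ : 2%:R * _ = 2%:R * (-1 * (w * s%:~R ^+ 2))); last by ring.
have m10 : -1 != 0 :> 'F_p by rewrite oppr_eq0 oner_neq0.
rewrite (eM 2%:R) ?Fp2_neq0 ?mulf_neq0 ?expf_neq0 //.
rewrite (eM (-1)) ?mulf_neq0 ?expf_neq0 // (eM w) ?expf_neq0 //.
rewrite (eX _ 2) // ew eN1.
move: (e _) (e _) (e _) es e24 => a b c; lia.
Qed.

End ParityOfExponents.

(** * Periodicity of the quartic character *)

Section Periodicity.
Variables (r : int) (p k : nat) (s : int) (p' k' : nat) (s' : int).
Hypothesis pP : prime p.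
Hypothesis pk : p = (4 * k).+1.
Hypothesis prs : p%:Z = r ^+ 2 + s ^+ 2.
Hypothesis pP' : prime p'.
Hypothesis pk' : p' = (4 * k').+1.
Hypothesis prs' : p'%:Z = r ^+ 2 + s' ^+ 2.
Let w := imag_unit p r s.
Let e := qindex k w.
Let A := jacobi_re k w.
Let B := jacobi_im k w.
Let w' := imag_unit p' r s'.
Let e' := qindex k' w'.
Let A' := jacobi_re k' w'.
Let B' := jacobi_im k' w'.
Let cardK := cardFp pP pk.
Let w2 : w ^+ 2 = -1 := imag_unit_sqr pP prs.
Let cardK' := cardFp pP' pk'.
Let w2' : w' ^+ 2 = -1 := imag_unit_sqr pP' prs'.

Hypothesis s16 : (16 %| s' - s)%Z.

Lemma period_witness : exists t, s' = s + 16 * t.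
Proof. by case/dvdzP: s16 => t tE; exists t; rewrite mulrC -tE addrC subrK. Qed.

Lemma index_periodic : k = k' %[mod 4].
Proof.
have [t sE] := period_witness.
have : p'%:Z = p%:Z + 16 * (2 * s * t + 16 * t ^+ 2).
  by rewrite prs prs' sE; ring.
by rewrite pk pk'; lia.
Qed.

(** The unit relating J to r + s i is determined by the congruence
    [jacobi_primary], hence by r and s modulo 4. *)
Lemma jacobi_unit_periodic : exists m n : int,
  [/\ m ^+ 2 + n ^+ 2 = 1, A = n * r + m * s /\ B = n * s - m * r &
      A' = n * r + m * s' /\ B' = n * s' - m * r].
Proof.
have [m [n [mn AE BE]]] := jacobi_assoc pP pk prs.
have [m' [n' [mn' AE' BE']]] := jacobi_assoc pP' pk' prs'.
rewrite -/w -/A in AE; rewrite -/w -/B in BE.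
rewrite -/w' -/A' in AE'; rewrite -/w' -/B' in BE'.
exists m, n; split=> //.
suff [-> ->] : m = m' /\ n = n' by [].
have [z [v [zE vE]]] := jacobi_primary cardK w2.
have [z' [v' [zE' vE']]] := jacobi_primary cardK' w2'.
rewrite -/A -/B in zE vE; rewrite -/A' -/B' in zE' vE'.
have [t sE] := period_witness.
move: AE BE AE' BE' zE vE zE' vE'; move: A B A' B' => a b a' b'; rewrite sE.
clear - mn mn'.
by case: (sqr_sum1 mn) => -[-> ->]; case: (sqr_sum1 mn') => -[-> ->]; lia.
Qed.

(** For odd l, the relations [quartic_residue1] and [quartic_residue3] for
    p and p' are compared in one finite field of characteristic l containing
    all the roots of unity needed; there J, p and (-1)^k agree with their
    counterparts for p'. *)
Lemma qindex_prime_periodic (l : nat) : prime l -> (l %| s' - s)%Z ->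
  l != p -> l != p' -> e l%:R = e' l%:R.
Proof.
move=> lP ls lp lp'; have kk := index_periodic; have [t sE] := period_witness.
have [ol|l2] := boolP (odd l); last first.
  have -> : l = 2%N by case: (even_prime lP) => // ol; rewrite ol in l2.
  have -> : e 2%:R = _ := qindex2 pP pk prs.
  have -> : e' 2%:R = _ := qindex2 pP' pk' prs'.
  have -> : pm3_mod8 (absz (r + s')) = pm3_mod8 (absz (r + s)).
    apply: pm3_mod8_mod; rewrite sE (_ : _ - _ = 2 * t * 8) ?dvdz_mull //; ring.
  by case: ifP => _; move: (pm3_mod8 _) kk => b; clear; lia.
have cop : coprime l (4 * (p * p')).
  rewrite !coprimeMr !prime_coprime // (dvdn_prime2 lP pP) (dvdn_prime2 lP pP').
  rewrite lp lp' !andbT.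
  rewrite (_ : 4 = 2 ^ 2)%N // Euclid_dvdX // andbT dvdn_prime2 //.
  by apply: contraTneq ol => ->.
have [F lF [z zp]] := ex_finField_prim_root lP cop.
have i4 : 4.-primitive_root (z ^+ (p * p')).
  by have := dvdn_prim_root zp (dvdn_mulr (p * p') (dvdnn 4)); rewrite mulKn.
have zpp : p.-primitive_root (z ^+ (4 * p')).
  have d : (p %| 4 * (p * p'))%N by rewrite mulnCA dvdn_mulr.
  by have := dvdn_prim_root zp d; rewrite mulnCA mulKn // prime_gt0.
have zpp' : p'.-primitive_root (z ^+ (4 * p)).
  have d : (p' %| 4 * (p * p'))%N by rewrite mulnA dvdn_mull.
  by have := dvdn_prim_root zp d; rewrite mulnA mulnK // prime_gt0.
have i2 := prim_root4_sqr i4; have F2 := two_neq0_pchar lF ol.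
move: (z ^+ (p * p')) i4 i2 => i i4 i2.
have p0 : p%:R != 0 :> F := prim_root_dvd_eq0 zpp (dvdnn p).
have p0' : p'%:R != 0 :> F := prim_root_dvd_eq0 zpp' (dvdnn p').
have l0 := odd_prime_neq0 pP lP lp.
have l0' := odd_prime_neq0 pP' lP lp'.
have sF : s'%:~R = s%:~R :> F.
  by apply/eqP; rewrite -subr_eq0 -rmorphB /= -(dvdz_pcharf lF).
have pF : p'%:R = p%:R :> F.
  by rewrite -[LHS]/(p'%:Z%:~R) -[RHS]/(p%:Z%:~R) prs prs' !rmorphD !rmorphXn /= sF.
have [m [n [_ [AE BE] [AE' BE']]]] := jacobi_unit_periodic.
have AF : A'%:~R = A%:~R :> F by rewrite AE AE' !rmorphD !rmorphM /= sF.
have BF : B'%:~R = B%:~R :> F by rewrite BE BE' !rmorphB !rmorphM /= sF.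
have el : (e l%:R < 4)%N := qindex_lt4 cardK w2 l0.
have el' : (e' l%:R < 4)%N := qindex_lt4 cardK' w2' l0'.
suff /eqP : i ^+ e l%:R == i ^+ e' l%:R.
  by move/eqP; rewrite (eq_prim_root_expr i4) !modn_small // => /eqP.
apply/eqP.
have [l1|l3] : (l = 4 * (l %/ 4) + 1 \/ l = 4 * (l %/ 4) + 3)%N.
  by clear -ol; lia.
  have H := quartic_residue1 cardK w2 i2 F2 (Fp_addcharD pP zpp) (Fp_addchar0 p _)
    (Fp_addchar_nontrivial pP zpp).
  rewrite card_Fp // in H; have {}H := H p0 l lF l0 _ l1.
  have H' := quartic_residue1 cardK' w2' i2 F2 (Fp_addcharD pP' zpp') (Fp_addchar0 p' _)
    (Fp_addchar_nontrivial pP' zpp').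
  rewrite card_Fp // in H'; have {}H' := H' p0' l lF l0' _ l1.
  rewrite -/A' -/B' -/e' AF BF pF in H'; rewrite -/A -/B -/e in H.
  move: H' H; set J := _ ^+ (l %/ 4)%N => H' H.
  have J0 : J != 0.
    by apply: contra_eq_neq H => ->; rewrite mulr0 eq_sym oner_eq0.
  by apply: (mulIf J0); rewrite H.
have H := quartic_residue3 cardK w2 i2 F2 (Fp_addcharD pP zpp) (Fp_addchar0 p _)
  (Fp_addchar_nontrivial pP zpp).
rewrite card_Fp // in H; have {}H := H p0 l lF l0 _ l3.
have H' := quartic_residue3 cardK' w2' i2 F2 (Fp_addcharD pP' zpp') (Fp_addchar0 p' _)
  (Fp_addchar_nontrivial pP' zpp').
rewrite card_Fp // in H'; have {}H' := H' p0' l lF l0' _ l3.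
rewrite -/A' -/B' -/e' AF BF pF in H'; rewrite -/A -/B -/e in H.
have kk2 : (-1) ^+ k' = (-1) ^+ k :> F.
  rewrite -signr_odd -[RHS]signr_odd; congr (_ ^+ nat_of_bool _).
  by rewrite -(@odd_mod k 4) // kk odd_mod.
rewrite kk2 in H'.
have c0 : (-1) ^+ k * p%:R != 0 :> F by rewrite mulf_neq0 // signr_eq0.
by apply: (mulIf c0); rewrite -H -H'.
Qed.

Lemma qindex_nat_periodic (u : nat) : (u %| s' - s)%Z -> ~~ (p %| u)%N ->
  ~~ (p' %| u)%N -> e u%:R = e' u%:R.
Proof.
elim/ltn_ind: u => u IH us pu pu'.
have [u1|u1] := eqVneq u 1%N; first by rewrite u1 /e /e' !qindex1.
have u2 : (1 < u)%N by move: pu u1; case: u {IH us pu'} => [|[]]; rewrite ?dvdn0.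
have lP := pdiv_prime u2; have := pdiv_dvd u.
move: (pdiv u) lP => l lP /dvdnP[u' uE].
have u'u : (u' < u)%N.
  by rewrite uE ltn_Pmulr ?prime_gt1 //; move: u2; rewrite uE; case: (u').
move: us pu pu'; rewrite uE !Euclid_dvdM // !negb_or.
move=> us /andP[pu pl] /andP[pu' pl'].
have eu : e u'%:R = e' u'%:R.
  by apply: IH => //; apply: dvdz_trans us; apply: dvdn_mulr.
have el : e l%:R = e' l%:R.
  apply: qindex_prime_periodic => //; first by apply: dvdz_trans us; apply: dvdn_mull.
    by apply: contraNneq pl => ->.
  by apply: contraNneq pl' => ->.
have M : e (u'%:R * l%:R) = ((e u'%:R + e l%:R) %% 4)%N.
  by apply: (qindexM cardK w2); rewrite -(dvdn_pcharf (pchar_Fp pP)).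
have M' : e' (u'%:R * l%:R) = ((e' u'%:R + e' l%:R) %% 4)%N.
  by apply: (qindexM cardK' w2'); rewrite -(dvdn_pcharf (pchar_Fp pP')).
by rewrite !natrM M M' eu el.
Qed.

Lemma qindex_periodic (D : int) : (D %| s' - s)%Z -> ~~ (p %| D)%Z ->
  ~~ (p' %| D)%Z -> e D%:~R = e' D%:~R.
Proof.
case: D => u us pu pu'; first exact: qindex_nat_periodic us pu pu'.
have eu : e u.+1%:R = e' u.+1%:R by apply: qindex_nat_periodic.
have u0 : u.+1%:R != 0 :> 'F_p by rewrite -(dvdn_pcharf (pchar_Fp pP)).
have u0' : u.+1%:R != 0 :> 'F_p' by rewrite -(dvdn_pcharf (pchar_Fp pP')).
have N : e (-1 * u.+1%:R) = ((e (-1)%R + e u.+1%:R) %% 4)%N.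
  by apply: (qindexM cardK w2); rewrite // oppr_eq0 oner_neq0.
have N' : e' (-1 * u.+1%:R) = ((e' (-1)%R + e' u.+1%:R) %% 4)%N.
  by apply: (qindexM cardK' w2'); rewrite // oppr_eq0 oner_neq0.
have N1 : e (-1) = ((2 * k) %% 4)%N := qindexN1 cardK w2.
have N1' : e' (-1) = ((2 * k') %% 4)%N := qindexN1 cardK' w2'.
rewrite NegzE !rmorphN /= -(mulN1r (u.+1%:R : 'F_p)) -(mulN1r (u.+1%:R : 'F_p')) N N' N1 N1' eu.
by rewrite -(modnMmr 2 k) index_periodic modnMmr.
Qed.

End Periodicity.

(** * Traces of Frobenius *)

Lemma wdisc_curveE (D : int) : wdisc (curve_E D) = - 64 * D ^+ 3.
Proof. by rewrite /wdisc /curve_E; ring. Qed.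

Lemma frob_trace_curveE (D : int) (p : nat) : frob_trace (curve_E D) p = p%:Z -
  #|[pred P : 'F_p * 'F_p | P.2 ^+ 2 == P.1 ^+ 3 + D%:~R * P.1]|%:Z.
Proof.
rewrite /frob_trace /npoints.
set n := #|_|; set m := #|_|; suff -> : n = m by lia.
apply: eq_card => -[x y]; rewrite !inE /=.
have -> : (0%:~R : 'F_p) = 0 by [].
apply/idP/idP => [/set_mem/= | H]; first by rewrite !mul0r !addr0.
by apply/mem_set => /=; rewrite !mul0r !addr0.
Qed.

Lemma good_primeP (D : int) (p : nat) : prime p ->
  ~~ (p%:Z %| wdisc (curve_E D))%Z = odd p && ~~ (p %| D)%Z.
Proof.
move=> pP; rewrite wdisc_curveE.
have -> : (p %| - 64 * D ^+ 3)%Z = (p %| 2 ^ 6 * (absz D) ^ 3)%N.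
  by rewrite dvdzE abszM abszX.
rewrite Euclid_dvdM // !Euclid_dvdX // !andbT dvdn_prime2 // negb_or.
by case: (even_prime pP) => [->//|op]; rewrite op; case: eqP op => // ->.
Qed.

Lemma frob_trace_3mod4 (D : int) (p k : nat) : prime p -> p = (4 * k + 3)%N ->
  frob_trace (curve_E D) p = 0.
Proof.
move=> pP pk; rewrite frob_trace_curveE.
by rewrite (curve_card_3mod4 (k := k)) card_Fp // subrr.
Qed.

(** The identity between integers is checked in the complex algebraic
    numbers, where the quartic character takes its values. *)
Lemma frob_trace_1mod4 (D : int) (p k : nat) (w : 'F_p) : prime p ->
  p = (4 * k).+1 -> w ^+ 2 = -1 -> ~~ (p %| D)%Z ->
  frob_trace (curve_E D) p = - (-1) ^+ k * 2 *
    (re_expi (qindex k w D%:~R) * jacobi_re k w + im_expi (qindex k w D%:~R) * jacobi_im k w).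
Proof.
move=> pP pk w2 pD; rewrite frob_trace_curveE.
have D0 : D%:~R != 0 :> 'F_p by rewrite -(dvdz_pcharf (pchar_Fp pP)).
have C2 : 2%:R != 0 :> algC by rewrite pnatr_eq0.
have := curve_card_1mod4 (cardFp pP pk) w2 (sqrCi algC) C2 D0.
set n := #|_|; rewrite card_Fp // => H.
have : n%:Z = p%:Z + (-1) ^+ k * 2 *
    (re_expi (qindex k w D%:~R) * jacobi_re k w + im_expi (qindex k w D%:~R) * jacobi_im k w).
  apply/eqP; rewrite -(eqr_int algC) -[n%:~R]/(n%:R) H.
  by rewrite !(rmorphD, rmorphM, rmorphXn, rmorphN, rmorph1) /=.
by move=> ->; ring.
Qed.

Lemma ex_imag_unit (p k : nat) : prime p -> p = (4 * k).+1 ->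
  exists w : 'F_p, w ^+ 2 = -1.
Proof.
move=> pP pk; have [g gp] := ex_generator (cardFp pP pk).
exists (g ^+ k); apply: prim_root4_sqr.
have k0 := quarter_gt0 (cardFp pP pk).
by have := dvdn_prim_root gp (dvdn_mulr k (dvdnn 4)); rewrite mulKn.
Qed.

Lemma expi_cases n : [\/ re_expi n = 1 /\ im_expi n = 0, re_expi n = -1 /\ im_expi n = 0,
  re_expi n = 0 /\ im_expi n = 1 | re_expi n = 0 /\ im_expi n = -1].
Proof.
rewrite /re_expi /im_expi; have := ltn_pmod n (isT : (0 < 4)%N).
case: (n %% 4)%N => [|[|[|[|m]]]] //= _.
- by constructor 1.
- by constructor 3.
- by constructor 2.
- by constructor 4.
Qed.

Lemma sign_cases k : (-1) ^+ k = 1 :> int \/ (-1) ^+ k = -1 :> int.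
Proof. by rewrite -signr_odd; case: (odd k); [right | left]. Qed.

Lemma trace_prime_1mod4 (D m : int) (p : nat) : m != 0 ->
  trace_prime (curve_E D) m p -> p = (4 * (p %/ 4)).+1.
Proof.
move=> m0 /and3P[pP]; rewrite good_primeP // => /andP[op pD] /eqP tr.
have [//|p3] : p = (4 * (p %/ 4)).+1 \/ p = (4 * (p %/ 4) + 3)%N by clear -op; lia.
by move: m0; rewrite -tr (frob_trace_3mod4 D pP p3) eqxx.
Qed.

Lemma trace_prime_two_squares (D m : int) (p : nat) : m != 0 ->
  trace_prime (curve_E D) m p ->
  exists2 r : int, m = 2 * r & exists s : nat, p%:Z = r ^+ 2 + s%:Z ^+ 2.
Proof.
move=> m0 tp; have pk := trace_prime_1mod4 m0 tp.
case/and3P: tp => pP; rewrite good_primeP // => /andP[op pD] /eqP tr.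
have [w w2] := ex_imag_unit pP pk.
have N := jacobi_norm_int pP pk w2.
have := frob_trace_1mod4 pP pk w2 pD; rewrite tr.
move: (jacobi_re _ w) (jacobi_im _ w) N => A B N.
have sqE (x : int) : (absz x)%:Z ^+ 2 = x ^+ 2 by rewrite abszE real_normK ?num_real.
by case: (expi_cases (qindex (p %/ 4) w D%:~R)) => -[-> ->];
  case: (sign_cases (p %/ 4)) => -> E;
  [exists (- A) | exists A | exists A | exists (- A) |
   exists (- B) | exists B | exists B | exists (- B)];
  rewrite ?E -?N; try ring;
  first [by exists (absz B); rewrite sqE; ring | by exists (absz A); rewrite sqE; ring].
Qed.

Lemma odd_two_squares (q : nat) (x y : int) : odd q ->
  q%:Z = x ^+ 2 + y ^+ 2 -> q = (4 * (q %/ 4)).+1.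
Proof.
move=> oq; have sqr_mod4 (a : int) : exists b : int, a ^+ 2 = 4 * b \/ a ^+ 2 = 4 * b + 1.
  have [aE|aE] : a = 2 * (a %/ 2)%Z \/ a = 2 * (a %/ 2)%Z + 1 by lia.
    by exists ((a %/ 2)%Z ^+ 2); left; rewrite {1}aE; ring.
  by exists ((a %/ 2)%Z ^+ 2 + (a %/ 2)%Z); right; rewrite {1}aE; ring.
have [b xE] := sqr_mod4 x; have [c yE] := sqr_mod4 y.
by case: xE => ->; case: yE => -> qE; move: oq qE; clear; lia.
Qed.

(** Both traces are 2 (a r + b s) with the same pair (a, b), for p and p'
    respectively, and (a, b) is a Gaussian unit.  Equality with 2r forces
    (a, b) = (1, 0), since r is nonzero and since s = r or s = -r would make p
    even. *)
Lemma frob_trace_periodic (D r s s' : int) (p p' : nat) : r != 0 ->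
  prime p -> prime p' -> ~~ (p%:Z %| wdisc (curve_E D))%Z ->
  ~~ (p'%:Z %| wdisc (curve_E D))%Z ->
  p%:Z = r ^+ 2 + s ^+ 2 -> p'%:Z = r ^+ 2 + s' ^+ 2 ->
  (16 * D %| s' - s)%Z ->
  frob_trace (curve_E D) p = 2 * r -> frob_trace (curve_E D) p' = 2 * r.
Proof.
move=> r0 pP pP'; rewrite !good_primeP // => /andP[op pD] /andP[op' pD'].
move=> prs prs' ss' tr.
have pk := odd_two_squares op prs; have pk' := odd_two_squares op' prs'.
have w2 := imag_unit_sqr pP prs; have w2' := imag_unit_sqr pP' prs'.
have s16 : (16 %| s' - s)%Z by apply: dvdz_trans ss'; apply: dvdz_mulr.
have sD : (D %| s' - s)%Z by apply: dvdz_trans ss'; apply: dvdz_mull.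
have [m [n [mn [AE BE] [AE' BE']]]] := jacobi_unit_periodic pP pk prs pP' pk' prs' s16.
have kk := index_periodic pP pk prs pP' pk' prs' s16.
have ee := qindex_periodic pP pk prs pP' pk' prs' s16 sD pD pD'.
rewrite (frob_trace_1mod4 pP pk w2 pD) in tr.
rewrite (frob_trace_1mod4 pP' pk' w2' pD') -ee.
have -> : (-1) ^+ (p' %/ 4) = (-1) ^+ (p %/ 4) :> int.
  rewrite -signr_odd -[RHS]signr_odd; congr (_ ^+ nat_of_bool _).
  by rewrite -(@odd_mod (p' %/ 4) 4) // -kk odd_mod.
rewrite AE' BE'; rewrite AE BE in tr.
have c2 : (-1) ^+ (p %/ 4) ^+ 2 = 1 :> int by rewrite sqrr_sign.
have RI : re_expi (qindex (p %/ 4) (imag_unit p r s) D%:~R) ^+ 2 +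
    im_expi (qindex (p %/ 4) (imag_unit p r s) D%:~R) ^+ 2 = 1.
  by case: (expi_cases (qindex (p %/ 4) (imag_unit p r s) D%:~R)) => -[-> ->].
move: (re_expi _) (im_expi _) (_ ^+ (p %/ 4)) RI c2 tr => R I c RI c2 tr.
pose a := - c * (R * n - I * m); pose b := - c * (R * m + I * n).
have ab : a ^+ 2 + b ^+ 2 = 1.
  transitivity (c ^+ 2 * (R ^+ 2 + I ^+ 2) * (m ^+ 2 + n ^+ 2)).
    by rewrite /a /b; ring.
  by rewrite c2 RI mn.
have abr : a * r + b * s = r.
  by apply: (mulfI (_ : 2 != 0)) => //; rewrite -tr /a /b; ring.
transitivity (2 * (a * r + b * s')); first by rewrite /a /b; ring.
have sr2 : s = r \/ s = - r -> False.
  by move=> H; move: op prs; case: H => ->; rewrite ?sqrrN; clear; lia.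
move: (a) (b) ab abr => {tr c2 RI mn} {}a {}b ab.
by case: (sqr_sum1 ab) => -[-> ->]; move: r0 sr2; clear; lia.
Qed.

(** * The function sqrt x / log x *)

Section SqrtOverLog.
Variable R : realType.
Implicit Types (x y C : R) (f h : nat -> R).
Let g : R -> R := @sqrt_over_log R.

Lemma sqrt_over_log_ge0 x : 1 <= x -> 0 <= g x.
Proof. by move=> x1; rewrite divr_ge0 ?sqrtr_ge0 ?ln_ge0. Qed.

Lemma sqrt_over_log_nat_ge0 (n : nat) : 0 <= g n%:R.
Proof.
case: n => [|n]; first by rewrite /g /sqrt_over_log sqrtr0 mul0r.
by rewrite sqrt_over_log_ge0 // ler1n.
Qed.

(** With z the fourth root of x, ln x = 4 ln z <= 4 z, so the quotient is at
    least z / 4. *)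
Lemma sqrt_over_log_unbounded x y : 1 <= y -> (4 * y) ^+ 4 <= x -> y <= g x.
Proof.
move=> y1 yx.
have x0 : 1 < x.
  apply: lt_le_trans yx; rewrite exprn_egt1 //; lra.
have [z z0 zx] : exists2 z : R, 0 < z & z ^+ 4 = x.
  exists (Num.sqrt (Num.sqrt x)); first by rewrite !sqrtr_gt0; lra.
  by rewrite (exprM _ 2 2) !sqr_sqrtr ?sqrtr_ge0 //; lra.
have yz : 4 * y <= z.
  rewrite -(ler_pXn2r (isT : (0 < 4)%N)) ?nnegrE ?zx //; last exact: ltW.
  lra.
have lnx : ln x <= 4 * z.
  rewrite -zx lnXn // -[ln z *+ 4]mulr_natl ler_pM2l ?ltr0n //.
  exact: ltW (ln_sublinear z0).
have sx : Num.sqrt x = z ^+ 2.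
  by rewrite -zx (exprM z 2 2) sqrtr_sqr ger0_norm // sqr_ge0.
rewrite /g /sqrt_over_log sx ler_pdivlMr ?ln_gt0 //.
apply: le_trans (_ : y * (4 * z) <= _); first by rewrite ler_pM2l //; lra.
by rewrite mulrA expr2 ler_pM2r // mulrC.
Qed.

(** The integer n next to x satisfies x < n <= x + 1, and both sqrt n and
    ln n exceed sqrt x and ln x by at most a factor 1 + d as soon as x is
    large. *)
Lemma sqrt_over_log_succ_truncn (d : R) : 0 < d -> exists X, forall x, X <= x ->
  `|g (Num.truncn x).+1%:R - g x| <= d * g x.
Proof.
move=> d0; exists (expR 1 + d^-1 + 1) => x xX.
have di : 0 < d^-1 by rewrite invr_gt0.
have e0 : 0 < expR (1 : R) by exact: expR_gt0.
have x1 : 1 <= x by lra.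
have lx1 : 1 <= ln x.
  by rewrite -[leLHS](expRK 1) ler_ln ?posrE; lra.
have x0 : 0 <= x by lra.
have /andP[tx xt] := Num.Theory.truncn_itv x0.
set n := (Num.truncn x).+1%:R : R.
have xn : x <= n by rewrite ltW.
have nx : n <= x + 1 by rewrite /n -natr1 lerD2r.
have dx : 1 <= d * x.
  by rewrite mulrC -ler_pdivrMr // div1r; lra.
have sx : 0 < Num.sqrt x by rewrite sqrtr_gt0; lra.
have sn : Num.sqrt n <= (1 + d) * Num.sqrt x.
  rewrite -[(1 + d)]ger0_norm; last by lra.
  rewrite -sqrtr_sqr -sqrtrM ?sqr_ge0 // ler_wsqrtr //; nra.
have ln_n : ln n <= (1 + d) * ln x.
  have -> : n = x * (1 + (n - x) / x) by field; lra.
  have q0 : 0 <= (n - x) / x by rewrite divr_ge0; lra.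
  rewrite lnM ?posrE //; [|lra|lra].
  rewrite [leRHS]mulrDl mul1r lerD2l.
  apply: (le_trans (le_ln1Dx _)); first by lra.
  rewrite ler_pdivrMr; last by lra.
  apply: (@le_trans _ _ (d * x)); first by lra.
  by rewrite mulrAC ler_peMr //; nra.
have lnn : ln x <= ln n by rewrite ler_ln ?posrE; lra.
have sqn : Num.sqrt x <= Num.sqrt n by rewrite ler_wsqrtr.
have up : g n <= (1 + d) * g x.
  rewrite /g /sqrt_over_log mulrA ler_pM ?sqrtr_ge0 ?invr_ge0 ?lef_pV2 ?posrE //; lra.
have lo : g x <= (1 + d) * g n.
  rewrite /g /sqrt_over_log mulrA ler_pdivrMr; last by lra.
  rewrite mulrAC ler_pdivlMr; last by lra.
  nra.
have gn0 : 0 <= g n by rewrite sqrt_over_log_ge0 //; lra.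
rewrite ler_norml; apply/andP; split; first by nra.
by lra.
Qed.

End SqrtOverLog.

(** * Asymptotics of counting functions *)

Lemma card_set_ord (n : nat) (P : nat -> bool) :
  #|[set p : 'I_n | P p]| = (\sum_(p < n) P p)%N.
Proof.
rewrite -sum1_card big_mkcond /=; apply: eq_bigr => p _.
have -> : (p \in [set p : 'I_n | P p]) = P p.
  by apply/idP/idP => [/set_mem|?] //; apply/mem_set.
by case: (P p).
Qed.

Section CountAsymptotics.
Variable R : realType.
Implicit Types (x y C : R) (f h : nat -> R).
Let g : R -> R := @sqrt_over_log R.

Lemma sqrt_over_log_nat_large (y : R) : 1 <= y -> exists N : nat,
  forall n, (N <= n)%N -> y <= g n%:R.
Proof.
move=> y1; exists (Num.truncn ((4 * y) ^+ 4)).+1 => n yn.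
apply: sqrt_over_log_unbounded => //; apply: ltW.
by apply: lt_le_trans (_ : (Num.truncn ((4 * y) ^+ 4)).+1%:R <= _);
  rewrite ?ler_nat // truncnS_gt.
Qed.

(** f n = C sqrt n / log n + o(sqrt n / log n), in a form that stays
    meaningful for C = 0 and is stable under sums. *)
Definition count_asymp f C := forall eps : R, 0 < eps -> exists N : nat,
  forall n, (N <= n)%N -> `|f n - C * g n%:R| <= eps * g n%:R.

(** Bounded perturbations are negligible because sqrt n / log n is
    unbounded. *)
Lemma count_asymp_bounded f h K C : (forall n, `|f n - h n| <= K) ->
  count_asymp h C -> count_asymp f C.
Proof.
move=> fh hC eps e0; have [N hN] := hC (eps / 2) (divr_gt0 e0 (ltr0Sn _ 1)).
(* y is chosen so that K <= (eps / 2) y. *)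
pose y := Num.max 1 (2 * K / eps).
have y1 : 1 <= y by rewrite le_max lexx.
have Ky : 2 * K / eps <= y by rewrite le_max lexx orbT.
have [M gM] := sqrt_over_log_nat_large y1.
exists (maxn N M) => n; rewrite geq_max => /andP[Nn /gM yg].
have {}Ky : 2 * K <= eps * g n%:R.
  by rewrite [leRHS]mulrC -ler_pdivrMr //; lra.
have -> : f n - C * g n%:R = (f n - h n) + (h n - C * g n%:R) by ring.
apply: le_trans (ler_normD _ _) _.
by have := fh n; have := hN n Nn; lra.
Qed.

Lemma count_asymp0 : count_asymp (fun=> 0) 0.
Proof.
move=> eps e0; exists 0%N => n _; rewrite mul0r subrr normr0.
by rewrite mulr_ge0 ?sqrt_over_log_nat_ge0 // ltW.
Qed.

Lemma count_asympD f h C C' : count_asymp f C -> count_asymp h C' ->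
  count_asymp (fun n => f n + h n) (C + C').
Proof.
move=> fC hC eps e0; have e2 : 0 < eps / 2 by rewrite divr_gt0.
have [N fN] := fC _ e2; have [M hM] := hC _ e2.
exists (maxn N M) => n; rewrite geq_max => /andP[/fN fn /hM hn].
have -> : f n + h n - (C + C') * g n%:R =
  (f n - C * g n%:R) + (h n - C' * g n%:R) by ring.
by apply: le_trans (ler_normD _ _) _; lra.
Qed.

Lemma count_asymp_sum (I : Type) (s : seq I) (P : pred I) (F : I -> nat -> R)
    (C : I -> R) : (forall i, P i -> count_asymp (F i) (C i)) ->
  count_asymp (fun n => \sum_(i <- s | P i) F i n) (\sum_(i <- s | P i) C i).
Proof.
move=> FC; elim: s => [|i s IH].
  rewrite big_nil; have := count_asymp0; congr count_asymp.
  by apply/funext => n; rewrite big_nil.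
rewrite big_cons; case: ifP => Pi.
  have := count_asympD (FC i Pi) IH; congr count_asymp.
  by apply/funext => n; rewrite big_cons Pi.
by move: IH; congr count_asymp; apply/funext => n; rewrite big_cons Pi.
Qed.

(** With it, the nonnegativity of the Hardy-Littlewood constants follows from
    the conjecture and needs no study of the infinite product. *)
Lemma count_asymp_ge0 f C : (forall n, 0 <= f n) -> count_asymp f C -> 0 <= C.
Proof.
move=> f0 fC; rewrite leNgt; apply/negP => C0.
have e0 : 0 < - C / 2 by lra.
have [N fN] := fC _ e0; have [M gM] := sqrt_over_log_nat_large (lexx 1).
have := fN _ (leq_maxl N M); have := gM _ (leq_maxr N M).
move: (f0 (maxn N M)); rewrite ler_norml => fn g1 /andP[_]; nra.
Qed.

Lemma count_asymp_real f C : 0 <= C -> count_asymp f C ->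
  forall eps : R, 0 < eps ->
  \forall x \near +oo, `|f (Num.truncn x).+1 - C * g x| <= eps * g x.
Proof.
move=> C0 fC eps e0.
have e4 : 0 < eps / 4 by rewrite divr_gt0.
have [N fN] := fC _ e4.
(* C d <= eps / 2 bounds the cost of passing from n to x. *)
pose d := Num.min 1 (eps / (2 * (C + 1))).
have d0 : 0 < d by rewrite /d lt_min ltr01 divr_gt0 //; lra.
have d1 : d <= 1 by rewrite /d ge_min lexx.
have dC : d * C <= eps / 2.
  have : d <= eps / (2 * (C + 1)) by rewrite /d ge_min lexx orbT.
  by rewrite ler_pdivlMr; [nra | lra].
have [X gX] := sqrt_over_log_succ_truncn d0.
near=> x.
have xX : X <= x by near: x; apply: nbhs_pinfty_ge; exact: num_real.
have x1 : 1 <= x by near: x; apply: nbhs_pinfty_ge; exact: num_real.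
have xN : N%:R <= x by near: x; apply: nbhs_pinfty_ge; exact: num_real.
have Nx : (N <= (Num.truncn x).+1)%N.
  by rewrite -(ler_nat R); apply: le_trans xN (ltW (truncnS_gt _)).
have := fN _ Nx; have := gX _ xX; have gx := sqrt_over_log_ge0 x1.
rewrite -/(g x) -/(g _) in gx *; set n := (Num.truncn x).+1.
rewrite -/n => gn fn.
have -> : f n - C * g x = (f n - C * g n%:R) + C * (g n%:R - g x) by ring.
apply: le_trans (ler_normD _ _) _; rewrite normrM (ger0_norm C0).
have gn2 : g n%:R <= 2 * g x by move: gn; rewrite ler_norml => /andP[_]; nra.
have : C * `|g n%:R - g x| <= C * (d * g x) by rewrite ler_wpM2l.
by nra.
Unshelve. all: by end_near.
Qed.

Lemma quad_count_asymp a b c C : C != 0 ->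
  quad_count R a b c ~_ \oo (fun n : nat => C * sqrt_over_log n%:R) ->
  count_asymp (quad_count R a b c) C.
Proof.
move=> C0 /eqaddoP H eps e0.
have [|N _ HN] := H (eps / `|C|); first by rewrite divr_gt0 // normr_gt0.
exists N => n Nn; have := HN n Nn.
rewrite /= normrM (ger0_norm (sqrt_over_log_nat_ge0 _ _)) mulrA divfK //.
by rewrite normr_eq0.
Qed.

Lemma trace_count_asymptotic E m f C : 0 < C -> count_asymp f C ->
  (forall x : R, trace_count E m x = f (Num.truncn x).+1) ->
  trace_asymptotic E m C /\ trace_equivalent E m C.
Proof.
move=> C0 fC tf; split.
  apply/eqaddoP => eps e0.
  have H := count_asymp_real (ltW C0) fC e0.
  near=> x; have x1 : 1 <= x by near: x; apply: nbhs_pinfty_ge; exact: num_real.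
  rewrite [X in `|X|](_ : _ = trace_count E m x - C * sqrt_over_log x) // tf.
  rewrite [X in _ <= _ * X]ger0_norm ?sqrt_over_log_ge0 //.
  by near: x.
apply/eqaddoP => eps e0.
have H := count_asymp_real (ltW C0) fC (mulr_gt0 e0 C0).
near=> x; have x1 : 1 <= x by near: x; apply: nbhs_pinfty_ge; exact: num_real.
rewrite [X in `|X| <= _](_ : _ = trace_count E m x - C * sqrt_over_log x) // tf.
have Cg : 0 <= C * sqrt_over_log x by rewrite mulr_ge0 ?sqrt_over_log_ge0 ?ltW.
rewrite [X in _ <= _ * X]ger0_norm // (mulrA eps).
by near: x.
Unshelve. all: by end_near.
Qed.

End CountAsymptotics.

(** * Primes in the residue classes *)

Lemma card_ord_bounded (n N : nat) (P : nat -> bool) :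
  (forall p, P p -> (p < N)%N) -> (\sum_(p < n) P p <= N)%N.
Proof.
move=> PN; rewrite -(big_mkord xpredT (fun p => P p : nat)).
apply: (@leq_trans (\sum_(0 <= p < n) (p < N)%N)).
  by apply: leq_sum => p _; case E: (P p) => //; rewrite PN.
elim: n => [|n IH]; first by rewrite big_geq.
have : (\sum_(0 <= p < n) (p < N) <= n)%N.
  by rewrite -[leqRHS]subn0 -[leqRHS]muln1 -sum_nat_const_nat leq_sum // => p _; case: (p < N)%N.
by rewrite big_nat_recr //=; move: IH; case: (ltnP n N) => nN IH; lia.
Qed.

Lemma finite_set_nat_bounded (A : set nat) : finite_set A ->
  exists N, forall p, A p -> (p < N)%N.
Proof.
move=> /finite_seqP[s ->]; exists (\max_(p <- s) p).+1 => p ps.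
by rewrite ltnS; apply: (@leq_bigmax_seq _ s xpredT id).
Qed.

Lemma finite_set_ltn (A : set nat) N : (forall p, A p -> (p < N)%N) -> finite_set A.
Proof. by move=> AN; apply: (sub_finite_set _ (finite_II N)) => p /AN. Qed.

Section HardyLittlewood.
Variable R : realType.

Lemma quad_countE a b c n :
  quad_count R a b c n = (\sum_(p < n) `[< quad_prime a b c p >])%N%:R.
Proof.
rewrite /quad_count; congr (_%:R); rewrite -(card_set_ord n (fun p => `[< quad_prime a b c p >])).
by [].
Qed.

Lemma trace_countE E m (x : R) :
  trace_count E m x = (\sum_(p < (Num.truncn x).+1) trace_prime E m p)%N%:R.
Proof. by rewrite /trace_count card_set_ord. Qed.

(** In both cases some d > 1 divides all values of the polynomial, so d is
    the only prime it can represent. *)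
Lemma quad_prime_degenerate (a b c : int) : 0 < a ->
  gcdz (gcdz a b) c != 1 \/ (2 %| a + b)%Z && (2 %| c)%Z ->
  finite_set [set p | quad_prime a b c p].
Proof.
move=> a0 H; have [d d1 dP] : exists2 d : nat, d != 1%N &
    (forall x : int, d %| a * x ^+ 2 + b * x + c)%Z.
  case: H => [g1|/andP[ab c2]].
    exists (absz (gcdz (gcdz a b) c)).
      by apply: contraNneq g1 => g1; rewrite -[gcdz _ _]/((absz (gcdz (gcdz a b) c))%:Z) g1.
    have gab := dvdz_gcdl (gcdz a b) c; have gc := dvdz_gcdr (gcdz a b) c.
    have ga := dvdz_trans gab (dvdz_gcdl a b).
    have gb := dvdz_trans gab (dvdz_gcdr a b).
    move=> x; have : (gcdz (gcdz a b) c %| a * x ^+ 2 + b * x + c)%Z.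
      by rewrite rpredD // rpredD // dvdz_mulr.
    by rewrite !dvdzE.
  exists 2%N => // x.
  rewrite (_ : _ + _ = (a + b) * x + a * (x * (x - 1)) + c); last by ring.
  have xx : (2 %| x * (x - 1))%Z.
    have [xE|xE] : x = 2 * (x %/ 2)%Z \/ x - 1 = 2 * (x %/ 2)%Z by lia.
      by rewrite xE -mulrA dvdz_mulr.
    by rewrite xE; apply: dvdz_mull; apply: dvdz_mulr.
  apply: rpredD => //; apply: rpredD; first exact: dvdz_mulr.
  exact: dvdz_mull.
apply: (@finite_set_ltn _ d.+1) => p [pP [x px]].
have : (d %| p)%N by have := dP x%:Z; rewrite -px.
by rewrite ltnS => /(prime_nt_dvdP pP d1) ->.
Qed.

Lemma quad_count_alternative (a b c : int) : Hardy_Littlewood R -> 0 < a ->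
  b ^+ 2 - 4 * a * c < 0 ->
  exists2 d : R, 0 <= d & count_asymp (quad_count R a b c) d /\
    (d = 0 -> finite_set [set p | quad_prime a b c p]).
Proof.
move=> HL a0 disc0.
have fin0 : finite_set [set p | quad_prime a b c p] ->
    exists2 d : R, 0 <= d & count_asymp (quad_count R a b c) d /\
    (d = 0 -> finite_set [set p | quad_prime a b c p]).
  move=> fin; exists 0 => //; split=> //.
  have [N AN] := finite_set_nat_bounded fin.
  apply: (@count_asymp_bounded _ _ (fun=> 0) N%:R); last exact: count_asymp0.
  move=> n; rewrite subr0 quad_countE normr_nat ler_nat.
  apply: (@card_ord_bounded n N (fun p => `[< quad_prime a b c p >])) => p.
  by move=> /asboolP /AN.
have [g1|g1] := eqVneq (gcdz (gcdz a b) c) 1; last first.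
  exact: (fin0 (quad_prime_degenerate a0 (or_introl g1))).
have [p2|p2] := boolP ((2 %| a + b)%Z && (2 %| c)%Z).
  exact: (fin0 (quad_prime_degenerate a0 (or_intror p2))).
have nsq : ~ exists k : int, b ^+ 2 - 4 * a * c = k ^+ 2.
  by move=> [k kE]; move: disc0; rewrite kE ltNge sqr_ge0.
have := HL a b c a0 g1 p2 nsq; case: eqVneq => [_|C0]; first exact: fin0.
move=> /(quad_count_asymp C0) qC; exists (HL_const R a b c).
  by apply: count_asymp_ge0 qC => n; rewrite quad_countE ler0n.
by split=> // C00; rewrite C00 eqxx in C0.
Qed.


Section TraceCounts.
Variables (D r : int).
Hypotheses (D0 : D != 0) (r0 : r != 0).
Hypothesis HL : Hardy_Littlewood R.
Let M : nat := (16 * absz D)%N.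
Let Q (t p : nat) := quad_prime (M%:Z ^+ 2) (2 * M%:Z * t%:Z) (t%:Z ^+ 2 + r ^+ 2) p.
Let tr (p : nat) := trace_prime (curve_E D) (2 * r) p.

(** The classes t modulo 16|D| that contain at least one s for which r^2 + s^2
    is a prime with trace 2r. *)
Definition trace_residue (t : nat) : bool :=
  `[< exists s p : nat, [/\ s = t %[mod M], p%:Z = r ^+ 2 + s%:Z ^+ 2 & tr p] >].

Lemma modulus_gt0 : (0 < M)%N. Proof. by rewrite muln_gt0 absz_gt0. Qed.

Lemma residue_quad_primeP (t p : nat) : (t < M)%N -> Q t p <->
  prime p /\ exists s : nat, s = t %[mod M] /\ p%:Z = r ^+ 2 + s%:Z ^+ 2.
Proof.
move=> tM; split=> [[pP [x px]]|[pP [s [st ps]]]]; split=> //.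
  exists (M * x + t)%N; split; first by rewrite mulnC modnMDl.
  by rewrite px PoszD PoszM; ring.
exists (s %/ M)%N; rewrite ps {1}(divn_eq s M) st (modn_small tM) PoszD PoszM.
ring.
Qed.

Lemma residue_alternative (t : nat) : exists2 d : R, 0 <= d &
  count_asymp (quad_count R (M%:Z ^+ 2) (2 * M%:Z * t%:Z) (t%:Z ^+ 2 + r ^+ 2)) d /\
  (d = 0 -> finite_set [set p | Q t p]).
Proof.
have M0 : 0 < M%:Z ^+ 2 by rewrite exprn_gt0 // ltz_nat modulus_gt0.
apply: quad_count_alternative => //.
rewrite (_ : _ - _ = - (4 * (M%:Z ^+ 2 * r ^+ 2))); last by ring.
by rewrite oppr_lt0 mulr_gt0 // mulr_gt0 // exprn_even_gt0.
Qed.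

Lemma trace_prime_residue (p : nat) : tr p ->
  exists2 t : 'I_M, trace_residue t & Q t p.
Proof.
move=> trp; have [||q qE [s ps]] := @trace_prime_two_squares D (2 * r) p.
- by rewrite mulf_neq0.
- exact: trp.
have {qE} qr : q = r by apply: (mulfI (_ : 2 != 0)).
rewrite qr in ps; have sM : (s %% M < M)%N by rewrite ltn_mod modulus_gt0.
exists (Ordinal sM) => /=.
  by apply/asboolP; exists s, p; rewrite modn_mod.
apply/residue_quad_primeP => //; split; first by case/and3P: trp.
by exists s; rewrite modn_mod.
Qed.

Lemma residue_trace_prime (t : 'I_M) (p : nat) : trace_residue t -> Q t p ->
  ~~ (p%:Z %| wdisc (curve_E D))%Z -> tr p.
Proof.
move=> /asboolP[s0 [p0 [s0t p0E trp0]]] /(residue_quad_primeP _ (ltn_ord t)).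
move=> [pP [s [st ps]]] pD; case/and3P: trp0 => p0P p0D /eqP tr0.
apply/and3P; split=> //; apply/eqP.
apply: (frob_trace_periodic r0 p0P pP p0D pD p0E ps) tr0.
have : (M%:Z %| s%:Z - s0%:Z)%Z.
  by rewrite -eqz_mod_dvd !modz_nat st s0t.
by rewrite !dvdzE abszM.
Qed.

(** p determines s up to sign, and s is nonnegative here. *)
Lemma residue_unique (t t' : 'I_M) p : Q t p -> Q t' p -> t = t'.
Proof.
move=> /(residue_quad_primeP _ (ltn_ord t))[_ [s [st ps]]].
move=> /(residue_quad_primeP _ (ltn_ord t'))[_ [s' [st' ps']]].
have ss : s = s'.
  have : s%:Z ^+ 2 = s'%:Z ^+ 2 by apply: (addrI (r ^+ 2)); rewrite -ps -ps'.
  by move=> /eqP; rewrite eqrXn2 // => /eqP[].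
apply/val_inj; rewrite /= -(modn_small (ltn_ord t)) -(modn_small (ltn_ord t')).
by rewrite -st -st' ss.
Qed.

Let S (p : nat) : nat := (\sum_(t < M | trace_residue t) `[< Q t p >])%N.

(** The classes account exactly for the primes with trace 2r, except that
    they may also contain divisors of the discriminant. *)
Lemma residue_count_bounds : exists N : nat, forall p : nat,
  (tr p <= S p <= tr p + (p < N))%N.
Proof.
exists (absz (wdisc (curve_E D))).+1 => p; apply/andP; split.
  case trp: (tr p) => //; have [t tres Qt] := trace_prime_residue trp.
  by rewrite /S (bigD1 t) //= asboolT.
have [t /andP[tres /asboolP Qt]|noQ] :=
  pickP (fun t : 'I_M => trace_residue t && `[< Q t p >]).
  rewrite /S (bigD1 t) //= asboolT // big1 => [|t' /andP[_ tt']]; last first.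
    by apply/eqP; rewrite eqb0; apply/asboolP => /(residue_unique Qt) tE; rewrite tE eqxx in tt'.
  have [pD|pD] := boolP (p%:Z %| wdisc (curve_E D))%Z; last first.
    by rewrite (residue_trace_prime tres Qt pD).
  have disc0 : (0 < absz (wdisc (curve_E D)))%N.
    by rewrite absz_gt0 wdisc_curveE mulf_neq0 // expf_neq0.
  by rewrite ltnS (dvdn_leq disc0 pD) addn0 leq_addl.
rewrite /S big1 // => t tres; apply/eqP; rewrite eqb0.
by have := noQ t; rewrite tres /= => ->.
Qed.

Lemma trace_dichotomy : exists2 d : R, 0 <= d &
  count_asymp (fun n => (\sum_(p < n) tr p)%N%:R) d /\
  (d = 0 -> trace_finite (curve_E D) (2 * r)).
Proof.
have H (t : 'I_M) := residue_alternative t.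
pose d (t : 'I_M) := projT1 (cid2 (H t)).
have d0 t : 0 <= d t by rewrite /d; case: cid2.
have dA (t : 'I_M) :
    count_asymp (quad_count R (M%:Z ^+ 2) (2 * M%:Z * t%:Z) (t%:Z ^+ 2 + r ^+ 2))
      (d t).
  by rewrite /d; case: cid2 => ? ? [].
have dF (t : 'I_M) : d t = 0 -> finite_set [set p | Q t p].
  by rewrite /d; case: cid2 => ? ? [].
exists (\sum_(t < M | trace_residue t) d t); first by apply: sumr_ge0.
split.
  have [N SN] := residue_count_bounds.
  have := @count_asymp_sum R _ (index_enum 'I_M) (fun t : 'I_M => trace_residue t)
    _ _ (fun t _ => dA t).
  apply: (count_asymp_bounded (K := N%:R)) => n.
  rewrite (eq_bigr (fun t : 'I_M => (\sum_(p < n) `[< Q t p >])%N%:R)) => [|t _]; last first.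
    exact: quad_countE.
  rewrite -natr_sum exchange_big /= -[X in (X%:R - _)]/(\sum_(p < n) tr p)%N.
  have lo : (\sum_(p < n) tr p <= \sum_(p < n) S p)%N.
    by apply: leq_sum => p _; have /andP[] := SN p.
  have hi : (\sum_(p < n) S p <= \sum_(p < n) tr p + N)%N.
    apply: (@leq_trans (\sum_(p < n) (tr p + (p < N)%N))%N).
      by apply: leq_sum => p _; have /andP[] := SN p.
    rewrite big_split leq_add2l.
    exact: (@card_ord_bounded n N (fun p => p < N)%N).
  rewrite distrC ger0_norm; last by rewrite subr_ge0 ler_nat.
  by rewrite lerBlDl -natrD ler_nat.
move=> /eqP; rewrite psumr_eq0 // => /allP dz.
have finU : finite_set (\bigcup_(t in [set t : 'I_M | trace_residue t]) [set p | Q t p]).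
  apply: bigcup_finite => // t /= tres; apply: dF; apply/eqP.
  by have := dz t (mem_index_enum t); rewrite tres.
apply: sub_finite_set finU => p /= trp.
by have [t tres Qt] := trace_prime_residue trp; exists t.
Qed.

End TraceCounts.
End HardyLittlewood.

Theorem theorem1p1 (R : realType) :
  (forall D : int, D != 0 -> Hardy_Littlewood R ->
     Lang_Trotter_CM R (curve_E D) /\
     (forall r : int, r != 0 ->
        exists2 delta : R, 0 <= delta &
          if delta == 0 then trace_finite (curve_E D) (2 * r)
          else trace_equivalent (curve_E D) (2 * r) delta))
  /\
  (forall (D r : int) (C : R), D != 0 -> r != 0 -> 0 < C ->
     trace_asymptotic (curve_E D) (2 * r) C ->
     infinite_set
       [set p : nat | prime p /\ exists x : int, p%:Z = x ^+ 2 + r ^+ 2]).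
Proof.
split=> [D D0 HL|D r C D0 r0 C0 asympC].
  have main (r : int) : r != 0 -> exists2 d : R, 0 <= d &
      if d == 0 then trace_finite (curve_E D) (2 * r)
      else trace_asymptotic (curve_E D) (2 * r) d /\
           trace_equivalent (curve_E D) (2 * r) d.
    move=> r0; have [d d0 [dA dF]] := trace_dichotomy D0 r0 HL.
    exists d => //; case: eqVneq => [/dF//|dn0].
    apply: (trace_count_asymptotic _ dA) => [|x]; first by rewrite lt_neqAle eq_sym dn0.
    exact: trace_countE.
  split=> [m m0|r /main[d d0 H]]; last by exists d => //; case: ifP H => // _ [].
  have [mE|mE] := eqVneq m (2 * (m %/ 2)%Z).
    have [|d d0 H] := main (m %/ 2)%Z.
      by apply: contraNneq m0 => q0; rewrite mE q0 mulr0.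
    by exists d => //; rewrite mE; case: ifP H => // _ [].
  (* The trace at a prime of good reduction is even, so no prime has trace m. *)
  exists 0 => //; rewrite eqxx /trace_finite.
  rewrite [X in finite_set X](_ : _ = set0) //; apply/seteqP; split=> // p /= tp.
  have [q qE _] := trace_prime_two_squares m0 tp.
  by move: mE; rewrite qE mulKz // eqxx.
apply: contraPnot asympC => finA /eqaddoP H.
have [N AN] := finite_set_nat_bounded finA.
have tN (x : R) : trace_count (curve_E D) (2 * r) x <= N%:R.
  rewrite trace_countE ler_nat; apply: (@card_ord_bounded _ N (trace_prime (curve_E D) (2 * r))).
  move=> p tp; apply: AN; split; first by case/and3P: tp.
  have m0 : 2 * r != 0 by rewrite mulf_neq0.
  have [q qE [s ps]] := trace_prime_two_squares m0 tp.
  have {}qE : r = q by apply: (mulfI (_ : 2 != 0)) qE.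
  by exists s%:Z; rewrite ps qE addrC.
have {}H := H (C / 2) (divr_gt0 C0 (ltr0Sn _ 1)).
(* Where sqrt x / log x >= y, half of the main term already exceeds N. *)
pose y : R := Num.max 1 (2 * (N%:R + 1) / C).
have y1 : 1 <= y by rewrite /y le_max lexx.
have yN : 2 * (N%:R + 1) <= C * y.
  by rewrite [leRHS]mulrC -ler_pdivrMr // /y le_max lexx orbT.
have /filter_ex[//] : \forall x \near (pinfty_nbhs R), False.
near=> x.
have x1 : 1 <= x by near: x; apply: nbhs_pinfty_ge; exact: num_real.
have xy : (4 * y) ^+ 4 <= x by near: x; apply: nbhs_pinfty_ge; exact: num_real.
have gy := sqrt_over_log_unbounded y1 xy.
have : `|trace_count (curve_E D) (2 * r) x - C * sqrt_over_log x|
    <= C / 2 * `|sqrt_over_log x| by near: x.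
rewrite [`|sqrt_over_log x|]ger0_norm; last by lra.
rewrite ler_norml => /andP[+ _]; have := tN x; nra.
Unshelve. all: by end_near.
Qed.
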